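(* Fix $\mu\ge0$. For any $X\in\mathcal S$ there exist positive scalars $(\xi_X,\beta_X,\gamma_X)$ such that for every $X'\in\mathcal S$ with $\|X'-X\|\le\gamma_X$, $$|\mathcal L(X',\mu)-\mathcal L(X,\mu)|\le\xi_X\|X'-X\|\quad\text{and}\quad\|\nabla_X\mathcal L(X',\mu)-\nabla_X\mathcal L(X,\mu)\|\le\beta_X\|X'-X\|.$$
   Context: Setting. $x_{t+1}=Ax_t+Bu_t+w_t$ with $x_t\in\mathbb R^n$, $u_t\in\mathbb R^m$; $\{w_t\}$ is an i.i.d. sequence with finite fourth moments, mean $\bar w=\mathbb E[w_t]$ and covariance $W=\mathbb E[(w_t-\bar w)(w_t-\bar w)^\top]>0$ (positive definite). $Q$ is positive semi-definite, $R$ is positive definite, $(A,B)$ is controllable and $(A,Q^{1/2})$ is observable. Let $M_3=\mathbb E[(w_t-\bar w)(w_t-\bar w)^\top Q(w_t-\bar w)]$ and let $\bar\rho\in\mathbb R$ be a given constant. A policy is $X=[K,l]$ with $K\in\mathbb R^{m\times n}$, $l\in\mathbb R^m$, meaning $u_t=-Kx_t+l$. $\mathcal S=\{[K,l]:\rho(A-BK)<1\}$ ($\rho(\cdot)$ = spectral radius). For $\mu\ge0$ let $Q_\mu=Q+4\mu QWQ$, $S=2\mu QM_3\in\mathbb R^n$, $c_\mu(x,u)=x^\top Q_\mu x+2x^\top S+u^\top Ru-\mu\bar\rho$. For $X\in\mathcal S$ the Lagrangian is $\mathcal L(X,\mu)=\lim_{T\to\infty}\tfrac1T\mathbb E[\sum_{t=0}^{T-1}c_\mu(x_t,u_t)]$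 with $u_t=-Kx_t+l$. $\nabla_X\mathcal L(X,\mu)\in\mathbb R^{m\times(n+1)}$ is its gradient in $X$. $\|\cdot\|$ is the spectral norm. *)

(* Defs.v *)
From HB Require Import structures.
From mathcomp Require Import all_boot all_order all_algebra complex.
From mathcomp Require Import all_classical all_reals all_analysis.

Set Implicit Arguments.
Unset Strict Implicit.
Unset Printing Implicit Defensive.

Import Order.TTheory GRing.Theory Num.Theory.
Import numFieldNormedType.Exports.

Local Open Scope classical_set_scope.
Local Open Scope ring_scope.

(** * Matrices *)

Definition l2norm (R : realType) (p : nat) (v : 'cV[R]_p) : R :=
  Num.sqrt (\sum_(i < p) v i 0 ^+ 2).

(* The norm inherited from the normed-module structure on matrices is the
   entrywise maximum, hence this separate definition. *)
Definition spectral_norm (R : realType) (p q : nat) (M : 'M[R]_(p, q)) : R :=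
  sup [set l2norm (M *m v) | v in [set v : 'cV[R]_q | l2norm v <= 1]].

(* Largest modulus of a complex eigenvalue. *)
Definition spectral_radius (R : realType) (n : nat) (M : 'M[R]_n) : R :=
  sup [set ComplexField.Normc.normc z |
       z in [set z : R[i] | eigenvalue (map_mx (real_complex R) M) z]].

Definition quad_form (R : realType) (p : nat) (M : 'M[R]_p) (x : 'cV[R]_p) : R :=
  (x^T *m M *m x) 0 0.

Definition possemidef (R : realType) (p : nat) (M : 'M[R]_p) : Prop :=
  M^T = M /\ forall x : 'cV[R]_p, 0 <= quad_form M x.

Definition posdef (R : realType) (p : nat) (M : 'M[R]_p) : Prop :=
  M^T = M /\ forall x : 'cV[R]_p, x != 0 -> 0 < quad_form M x.

(* [H] is the positive semi-definite square root of [M]; it exists and is unique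
   as soon as [M] is positive semi-definite. *)
Definition is_possemidef_sqrt (R : realType) (p : nat) (M H : 'M[R]_p) : Prop :=
  possemidef H /\ H *m H = M.

Definition controllable (R : realType) (n m : nat)
    (A : 'M[R]_n) (B : 'M[R]_(n, m)) : Prop :=
  \rank (\mxrow_(i < n) (A ^+ i *m B)) = n.

Definition observable (R : realType) (n p : nat)
    (A : 'M[R]_n) (C : 'M[R]_(p, n)) : Prop :=
  \rank (\mxcol_(i < n) (C *m A ^+ i)) = n.

(* ['D_v f] is a total operator with an unspecified value where the directional
   derivative does not exist; the Lagrangian below is differentiable at every
   stabilizing policy, and the set of stabilizing policies is open. *)
Definition gradient (R : realType) (p q : nat) (f : 'M[R]_(p, q) -> R)
    (X : 'M[R]_(p, q)) : 'M[R]_(p, q) :=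
  \matrix_(i < p, j < q) 'D_(delta_mx i j) f X.

(** * Random vectors *)

(* R^n with its Borel sigma-algebra, so that [{RV P >-> borel_cV R n}] is the
   type of R^n-valued random vectors. *)
Definition borel_cV (R : realType) (n : nat) :=
  g_sigma_algebraType (@open 'cV[R]_n).

Definition mutually_independent d d' (T : measurableType d)
    (T' : measurableType d') (R : realType) (P : probability T R)
    (I : eqType) (X : I -> {RV P >-> T'}) : Prop :=
  forall (J : seq I) (E : I -> set T'), uniq J ->
    (forall i, i \in J -> measurable (E i)) ->
    P (\bigcap_(i in [set` J]) (X i @^-1` E i)) =
    (\prod_(i <- J) P (X i @^-1` E i))%E.

Definition identically_distributed d d' (T : measurableType d)
    (T' : measurableType d') (R : realType) (P : probability T R)
    (I : Type) (X : I -> {RV P >-> T'}) : Prop :=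
  forall (i j : I) (E : set T'), measurable E ->
    distribution P (X i) E = distribution P (X j) E.

Definition mx_expectation d (T : measurableType d) (R : realType)
    (P : probability T R) (p q : nat) (X : T -> 'M[R]_(p, q)) : 'M[R]_(p, q) :=
  \matrix_(i < p, j < q) fine 'E_P[fun omega => X omega i j].

Definition mean_vec d (T : measurableType d) (R : realType)
    (P : probability T R) (n : nat) (v : T -> 'cV[R]_n) : 'cV[R]_n :=
  mx_expectation P v.

Definition cov_mx d (T : measurableType d) (R : realType)
    (P : probability T R) (n : nat) (v : T -> 'cV[R]_n) : 'M[R]_n :=
  mx_expectation P (fun omega =>
    (v omega - mean_vec P v) *m (v omega - mean_vec P v)^T).

Definition third_moment d (T : measurableType d) (R : realType)
    (P : probability T R) (n : nat) (Q : 'M[R]_n) (v : T -> 'cV[R]_n)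
    : 'cV[R]_n :=
  mx_expectation P (fun omega =>
    (v omega - mean_vec P v) *m (v omega - mean_vec P v)^T *m Q
      *m (v omega - mean_vec P v)).

(** * Controlled linear system and Lagrangian *)

(* A policy [X = row_mx K l] acts by [u = - K x + l]. *)
Definition control (R : realType) (n m : nat) (X : 'M[R]_(m, n + 1))
    (x : 'cV[R]_n) : 'cV[R]_m :=
  - lsubmx X *m x + rsubmx X.

Definition stabilizing (R : realType) (n m : nat) (A : 'M[R]_n)
    (B : 'M[R]_(n, m)) : set 'M[R]_(m, n + 1) :=
  [set X | spectral_radius (A - B *m lsubmx X) < 1].

(* Closed-loop state at time [t] from the initial state [x0], for one
   realization [w] of the noise. *)
Fixpoint state (R : realType) (n m : nat) (A : 'M[R]_n) (B : 'M[R]_(n, m))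
    (X : 'M[R]_(m, n + 1)) (x0 : 'cV[R]_n) (w : nat -> 'cV[R]_n) (t : nat)
    : 'cV[R]_n :=
  if t is s.+1 then
    let x := state A B X x0 w s in A *m x + B *m control X x + w s
  else x0.

(* [c_mu], as a function of the covariance [W] and third moment [M3]. *)
Definition stage_cost (R : realType) (n m : nat) (Q : 'M[R]_n) (Ru : 'M[R]_m)
    (W : 'M[R]_n) (M3 : 'cV[R]_n) (rho mu : R) (x : 'cV[R]_n) (u : 'cV[R]_m)
    : R :=
  let Qmu := Q + (4 * mu) *: (Q *m W *m Q) in
  let S := (2 * mu) *: (Q *m M3) in
  quad_form Qmu x + 2 * (x^T *m S) 0 0 + quad_form Ru u - mu * rho.

(* [limn] and [fine] are total operators. For a stabilizing [X], an integrable
   [|x0|^2] and i.i.d. noise with finite fourth moments, all the expectations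
   are finite and the limit exists. *)
Definition lagrangian d (T : measurableType d) (R : realType)
    (P : probability T R) (n m : nat) (A : 'M[R]_n) (B : 'M[R]_(n, m))
    (Q : 'M[R]_n) (Ru : 'M[R]_m) (x0 : T -> 'cV[R]_n)
    (w : nat -> T -> 'cV[R]_n) (rho mu : R) (X : 'M[R]_(m, n + 1)) : R :=
  let c := stage_cost Q Ru (cov_mx P (w 0%N)) (third_moment P Q (w 0%N))
             rho mu in
  let x t omega := state A B X (x0 omega) (fun s => w s omega) t in
  limn (fun N : nat => N%:R^-1 *
    fine 'E_P[fun omega =>
      \sum_(t < N) c (x t omega) (control X (x t omega))]).

(* Main.v *)
Require Import Defs.
From HB Require Import structures.
From mathcomp Require Import all_boot all_order all_algebra complex.
From mathcomp Require Import all_classical all_reals all_analysis.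
From mathcomp Require Import measurable_realfun.
From mathcomp Require Import ring lra.

Set Implicit Arguments.
Unset Strict Implicit.
Unset Printing Implicit Defensive.

Import Order.TTheory GRing.Theory Num.Theory.
Import numFieldNormedType.Exports.

Local Open Scope classical_set_scope.
Local Open Scope ring_scope.

(* A policy [X] with closed loop [F = A - B K] splits the state as
   [x_t = F^t x_0 + m_t + y_t], where [m_t] is deterministic and [y_t] is driven
   by the centered noise.  As [F^t] tends to 0, the terms carrying [x_0] vanish
   (second moments being bounded, whatever the correlation of [x_0] with the
   noise), [m_t] tends to [(1 - F)^-1 (B l + E w)], and the covariance of [y_t]
   tends to the solution of [C = F C F^T + W], a linear equation whose matrix is
   invertible.  By Cramer's rule the Lagrangian is thus, near [X], a rational
   function of the entries of the policy with nonvanishing denominator.  The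
   estimates follow because pointwise Lipschitz functions with pointwise
   Lipschitz partial derivatives are closed under the field operations.
   Stability enters only through [F^t --> 0], which follows from [rho(F) < 1] by
   the Cayley-Hamilton theorem over the complex numbers, and which is an open
   condition on [F] because it amounts to some power of [F] being small. *)

(** * Stable matrices *)

(** A discrete Gronwall estimate. The strict gap [q < r] leaves room for the forcing term even when
    it grows at the rate of [z] itself, so repeated eigenvalues need no separate treatment. *)
Lemma recurrence_geometric (K : numFieldType) (u : nat -> K) (z q r c : K) :
  `|z| <= q -> q < r -> 0 <= c ->
  (forall k, `|u k.+1 - z * u k| <= c * r ^+ k) ->
  exists2 D, 0 <= D & forall k, `|u k| <= D * r ^+ k.
Proof.
move=> zq qr c0 uk; have q0 : 0 <= q by apply: le_trans zq.
have rq0 : 0 < r - q by rewrite subr_gt0.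
have r0 : 0 <= r by apply: ltW; apply: le_lt_trans qr.
(* The number [e = c / (r - q)] solves [c + q e = r e], so that any [D >= e] satisfies
   [c + q D <= r D]; adding [|u 0|] covers the initial value. *)
exists (`|u 0%N| + c / (r - q)); first by rewrite addr_ge0 // divr_ge0 // ltW.
elim=> [|k IH]; first by rewrite expr0 mulr1 lerDl divr_ge0 // ltW.
have -> : u k.+1 = (u k.+1 - z * u k) + z * u k by rewrite subrK.
apply: le_trans (ler_normD _ _) _; rewrite normrM.
apply: (@le_trans _ _ (c * r ^+ k + q * ((`|u 0%N| + c / (r - q)) * r ^+ k))).
  by apply: lerD; [exact: uk | apply: ler_pM].
rewrite exprS [leRHS]mulrCA mulrA [q * _]mulrA -mulrDl [r * _ * _]mulrC [leLHS]mulrC.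
apply: ler_wpM2l; first exact: exprn_ge0.
have -> : c = c / (r - q) * (r - q) by rewrite divfK // gt_eqF.
set e := c / (r - q); have -> : e * (r - q) / (r - q) = e by rewrite mulfK // gt_eqF.
rewrite -subr_ge0.
have -> : r * (`|u 0%N| + e) - (e * (r - q) + q * (`|u 0%N| + e)) = `|u 0%N| * (r - q) by ring.
by rewrite mulr_ge0 // ltW.
Qed.

Definition geometric_decay (K : numFieldType) (p q : nat) (r : K)
    (U : nat -> 'M[K]_(p, q)) :=
  forall i j, exists2 D, 0 <= D & forall k, `|U k i j| <= D * r ^+ k.

(** Each entry [u] of [M ^+ k * N] satisfies [u (k+1) - z u k = f k], where [f] is the same entry of
    the sequence assumed to decay. *)
Lemma geometric_decay_step (K : numFieldType) (n : nat) (M N : 'M[K]_n.+1)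
    (z q r : K) :
  `|z| <= q -> q < r ->
  geometric_decay r (fun k => M ^+ k * ((M - z%:M) * N)) ->
  geometric_decay r (fun k => M ^+ k * N).
Proof.
move=> zq qr H i j; have [c c0 Hc] := H i j.
apply: (recurrence_geometric zq qr c0) => k.
have -> // : (M ^+ k.+1 * N) i j - z * (M ^+ k * N) i j
    = (M ^+ k * ((M - z%:M) * N)) i j.
rewrite mulrBl mulrBr mulrA -exprSr [RHS]mxE [X in _ = _ + X]mxE; congr (_ - _).
rewrite -[M ^+ k * (z%:M * N)]/(M ^+ k *m (z%:M *m N)) mul_scalar_mx.
by rewrite -scalemxAr [RHS]mxE.
Qed.

(* Peels off the eigenvalues one at a time, starting from the sequence that
   Cayley-Hamilton makes identically zero. *)
Lemma geometric_decay_prod (K : numFieldType) (n : nat) (M : 'M[K]_n.+1)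
    (s : seq K) (q r : K) (N : 'M[K]_n.+1) :
  (forall z, z \in s -> `|z| <= q) -> q < r ->
  geometric_decay r (fun k => M ^+ k * (\prod_(z <- s) (M - z%:M) * N)) ->
  geometric_decay r (fun k => M ^+ k * N).
Proof.
elim: s => [|z s IH] Hs qr; first by rewrite big_nil mul1r.
rewrite big_cons -mulrA => H; apply: IH => //.
  by move=> y ys; apply: Hs; rewrite in_cons ys orbT.
by apply: (@geometric_decay_step _ _ _ _ z q) => //; apply: Hs; rewrite mem_head.
Qed.

(** Choosing [r] strictly above the moduli absorbs the polynomial factors that Jordan blocks
    produce, without any Jordan form. *)
Lemma geometric_decay_eigen (K : numClosedFieldType) (n : nat)
    (M : 'M[K]_n.+1) (q r : K) :
  0 <= q -> q < r -> (forall z, eigenvalue M z -> `|z| <= q) ->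
  geometric_decay r (fun k => M ^+ k).
Proof.
move=> q0 qr H.
have [s Hs] := closed_field_poly_normal (char_poly M).
have /monicP lc := char_poly_monic M; rewrite lc scale1r in Hs.
suff : geometric_decay r (fun k => M ^+ k * 1).
  by move=> + i j => /(_ i j)[D D0 HD]; exists D => // k; rewrite -[M ^+ k]mulr1.
apply: (@geometric_decay_prod _ _ _ s q) => //.
  move=> z zs; apply: H; rewrite eigenvalue_root_char Hs.
  by rewrite root_prod_XsubC.
have -> : \prod_(z <- s) (M - z%:M) = 0.
  rewrite -[RHS](Cayley_Hamilton M) Hs rmorph_prod; apply: eq_bigr => z _.
  by rewrite rmorphB /= horner_mx_X horner_mx_C.
move=> i j; exists 0 => // k; rewrite mul0r mulr0 mxE normr0 mul0r; exact: lexx.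
Qed.

(** * Powers of real stable matrices *)

Section Stability.
Variable R : realType.

Lemma normr_entry_le p q (M : 'M[R]_(p, q)) i j : `|M i j| <= `|M|.
Proof.
rewrite [leRHS]/Num.norm /= mx_normrE; apply/bigmax_geP; right.
by exists (i, j).
Qed.

Lemma normr_mx_le p q (M : 'M[R]_(p, q)) (c : R) :
  0 <= c -> (forall i j, `|M i j| <= c) -> `|M| <= c.
Proof.
by move=> c0 H; rewrite [leLHS]/Num.norm /= mx_normrE; apply/bigmax_leP; split.
Qed.

(** The entrywise maximum is not submultiplicative; the factor [q] counts the terms of the inner
    sum. *)
Lemma normr_mulmx_le p q s (M : 'M[R]_(p, q)) (N : 'M[R]_(q, s)) :
  `|M *m N| <= q%:R * (`|M| * `|N|).
Proof.
apply: normr_mx_le => [|i j]; first by rewrite !mulr_ge0.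
rewrite mxE; apply: le_trans (ler_norm_sum _ _ _) _.
apply: (@le_trans _ _ (\sum_(k < q) (`|M| * `|N|))).
  by apply: ler_sum => k _; rewrite normrM ler_pM // normr_entry_le.
by rewrite sumr_const card_ord mulr_natl.
Qed.

Definition power_stable n (M : 'M[R]_n) := (fun k => `|M ^+ k|) @ \oo --> (0 : R).

Lemma geometric_decay_cvg n (M : 'M[R]_n) (r : R) : 0 <= r -> r < 1 ->
  geometric_decay r (fun k => M ^+ k) -> power_stable M.
Proof.
move=> r0 r1 H.
have {}H : forall ij : 'I_n * 'I_n, exists D, 0 <= D /\ forall k, `|(M ^+ k) ij.1 ij.2| <= D * r ^+ k.
  by move=> [i j]; have [D D0 HD] := H i j; exists D.
have [D HD] := choice H.
have Hs k : `|M ^+ k| <= (\sum_ij D ij) * r ^+ k.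
  apply: normr_mx_le => [|i j].
    by rewrite mulr_ge0 ?exprn_ge0 // sumr_ge0 // => ij _; case: (HD ij).
  apply: le_trans ((HD (i, j)).2 k) _; apply: ler_wpM2r; first exact: exprn_ge0.
  rewrite (bigD1 (i, j)) //= lerDl sumr_ge0 // => ij _; by case: (HD ij).
apply: (@squeeze_cvgr _ _ _ _ (cst 0) (fun k => (\sum_ij D ij) * r ^+ k)).
- by near=> k; rewrite /= normr_ge0 Hs.
- exact: cvg_cst.
- rewrite -[X in _ --> X](mulr0 (\sum_ij D ij)).
  apply: cvgMr; apply: cvg_expr; by rewrite ger0_norm.
Unshelve. all: by end_near.
Qed.

Lemma eigenvalue_le_spectral_radius n (M : 'M[R]_n) (z : R[i]) :
  eigenvalue (map_mx (real_complex R) M) z ->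
  ComplexField.Normc.normc z <= spectral_radius M.
Proof.
move=> Hz; apply: sup_ubound; last by exists z.
set p := char_poly (map_mx (real_complex R) M).
have [s Hs] := closed_field_poly_normal p.
have /monicP lc := char_poly_monic (map_mx (real_complex R) M); rewrite lc scale1r in Hs.
(* A supremum bounds its set only if the set has an upper bound: here, the sum of the moduli of all
   roots of the characteristic polynomial. *)
exists (\sum_(y <- s) ComplexField.Normc.normc y) => _ [y Hy <-].
have : eigenvalue (map_mx (real_complex R) M) y by [].
rewrite eigenvalue_root_char -/p Hs root_prod_XsubC => ys.
by rewrite (big_rem y) //= lerDl sumr_ge0 // => -[? ?] _; rewrite sqrtr_ge0.
Qed.

Lemma spectral_radius_power_stable n (M : 'M[R]_n) :
  spectral_radius M < 1 -> power_stable M.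
Proof.
(* The eigenvalue argument works in size [n.+1], where square matrices form a nontrivial ring; in
   size 0 every norm is 0. *)
case: n M => [|n] M H.
  rewrite /power_stable; apply: (@cvg_trans _ (cst (0 : R) @ \oo)); last exact: cvg_cst.
  by apply: near_eq_cvg; near=> k; rewrite /= [M ^+ k]flatmx0 normr0.
(* The maximum with 0 gives [0 <= q] without exhibiting an eigenvalue; [r] below is the midpoint of
   [q] and 1. *)
set q := Num.max 0 (spectral_radius M).
have q0 : 0 <= q by rewrite le_max lexx.
have q1 : q < 1 by rewrite gt_max ltr01.
pose r := (q + 1) / 2.
have qr : q < r by rewrite /r; lra.
apply: (@geometric_decay_cvg _ _ r); [by lra | by rewrite /r; lra|].
have := @geometric_decay_eigen _ n (map_mx (real_complex R) M) q%:C%C r%:C%C.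
rewrite lecR ltcR => /(_ q0 qr) Hd.
have {}Hd : geometric_decay r%:C%C (fun k => map_mx (real_complex R) M ^+ k).
  apply: Hd => z /eigenvalue_le_spectral_radius Hz.
  rewrite -[`|z|]/((ComplexField.Normc.normc z)%:C%C) lecR.
  by apply: le_trans Hz _; rewrite le_max lexx orbT.
move=> i j; have [D D0 HD] := Hd i j.
(* A nonnegative complex number is real, so the decay constant descends to [R]. *)
have DE : D = (complex.Re D)%:C%C.
  by move: D0; case: (D) => a b; rewrite lecE /= => /andP[/eqP -> _].
exists (complex.Re D) => [|k]; first by rewrite -lecR -DE.
move: (HD k); rewrite -(rmorphXn (map_mx (real_complex R))) mxE DE.
rewrite -rmorphXn -rmorphM /= -[`|_|]/((ComplexField.Normc.normc _)%:C%C) lecR.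
by rewrite /= expr0n addr0 sqrtr_sqr.
Unshelve. all: by end_near.
Qed.

(** Every block of [k] steps halves [f], so [f t] is at most [2^-(t %/ k)] times the sum [D] of the
    values on the first block. *)
Lemma contraction_cvg (f : nat -> R) (k : nat) : (0 < k)%N ->
  (forall t, 0 <= f t) -> (forall t, f (t + k)%N <= f t / 2) ->
  f @ \oo --> (0 : R).
Proof.
move=> k0 f0 Hf.
have Hq q s : f (q * k + s)%N <= f s * 2^-1 ^+ q.
  elim: q => [|q IH]; first by rewrite mul0n add0n expr0 mulr1.
  rewrite mulSn -addnA addnC exprSr mulrA.
  by apply: le_trans (Hf _) _; rewrite ler_wpM2r // invr_ge0.
pose D := \sum_(s < k) f s.
have HD t : f t <= D * 2^-1 ^+ (t %/ k).
  rewrite {1}(divn_eq t k); apply: le_trans (Hq _ _) _.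
  rewrite ler_wpM2r ?exprn_ge0 ?invr_ge0 //.
  rewrite /D (bigD1 (Ordinal (ltn_pmod t k0))) //= lerDl.
  by apply: sumr_ge0 => s _.
apply: (@squeeze_cvgr _ _ _ _ (cst 0) (fun t => D * 2^-1 ^+ (t %/ k))).
- by near=> t; rewrite /= f0 HD.
- exact: cvg_cst.
- rewrite -[X in _ --> X](mulr0 D); apply: cvgMr.
  apply: (@cvg_comp _ _ _ (fun t => t %/ k)%N (fun q => 2^-1 ^+ q) _ \oo).
    move=> S [N _ HN]; exists (N * k)%N => // t /= Ht; apply: HN => /=.
    by rewrite leq_divRL.
  by apply: cvg_expr; rewrite ger0_norm ?invr_ge0 // invf_lt1 // ltr1n.
Unshelve. all: by end_near.
Qed.

(** The factor [n] is the one lost in [normr_mulmx_le]. A bound on a single power, unlike the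
    convergence of all powers, can be carried over to nearby matrices. *)
Lemma power_stable_contraction n (M : 'M[R]_n) (k : nat) : (0 < k)%N ->
  n%:R * `|M ^+ k| <= 2^-1 -> power_stable M.
Proof.
move=> k0 H; apply: (@contraction_cvg _ k) => // t.
rewrite exprD; apply: le_trans (normr_mulmx_le _ _) _.
by rewrite mulrCA ler_wpM2l.
Qed.

Lemma power_stable_contracts n (M : 'M[R]_n) (e : R) : 0 < e -> power_stable M ->
  exists2 k, (0 < k)%N & `|M ^+ k| < e.
Proof.
move=> e0 /cvgrPdist_lt /(_ e e0)[N _ HN].
(* The index [N.+1] rather than [N] guarantees a positive exponent. *)
exists N.+1 => //; have := HN N.+1 (leqnSn N).
by rewrite /= sub0r normrN normr_id.
Qed.

(** Iterating the equation gives [V = M^k V (M^k)^T] for all [k], and the right-hand side tends to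
    0. This is uniqueness for the Lyapunov equation. *)
Lemma power_stable_conj0 n (M V : 'M[R]_n) :
  power_stable M -> M *m V *m M^T = V -> V = 0.
Proof.
move=> H HV.
have HVk k : M ^+ k *m V *m (M ^+ k)^T = V.
  elim: k => [|k IH]; first by rewrite expr0 trmx1 mul1mx mulmx1.
  rewrite exprS trmx_mul !mulmxA -[RHS]HV -[in RHS]IH !mulmxA.
  by rewrite -[M * M ^+ k]/(M *m M ^+ k).
have tr_le (N : 'M[R]_n) : `|N^T| <= `|N|.
  by apply: normr_mx_le => // i j; rewrite mxE normr_entry_le.
have Hle k : `|V| <= n%:R * n%:R * `|V| * (`|M ^+ k| * `|M ^+ k|).
  rewrite -[leLHS](congr1 Num.norm (HVk k)).
  apply: le_trans (normr_mulmx_le _ _) _.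
  rewrite -!mulrA ler_wpM2l //.
  apply: le_trans (ler_pM _ _ (normr_mulmx_le _ _) (tr_le _)) _ => //.
  by rewrite -!mulrA [`|V| * (_ * _)]mulrCA.
have : `|V| <= 0.
  have : (fun k => n%:R * n%:R * `|V| * (`|M ^+ k| * `|M ^+ k|)) @ \oo --> n%:R * n%:R * `|V| * (0 * 0).
    by apply: cvgMr; apply: cvgM.
  rewrite mul0r mulr0 => Hc; rewrite -(cvg_lim _ Hc) //.
  apply: limr_ge; first by apply/cvg_ex; eexists; exact: Hc.
  by near=> k.
by rewrite normr_le0 => /eqP.
Unshelve. all: by end_near.
Qed.

Lemma power_stable_mulmx_cvg n p (M : 'M[R]_n) (V : 'M[R]_(n, p)) i j :
  power_stable M -> (fun k => (M ^+ k *m V) i j) @ \oo --> (0 : R).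
Proof.
move=> H; suff Hn : (fun k => `|(M ^+ k *m V) i j|) @ \oo --> (0 : R) by exact: norm_cvg0 Hn.
apply: (@squeeze_cvgr _ _ _ _ (cst 0) (fun k => n%:R * `|V| * `|M ^+ k|)).
- near=> k; rewrite /= normr_ge0 /=.
  apply: le_trans (normr_entry_le _ _ _) _; apply: le_trans (normr_mulmx_le _ _) _.
  by rewrite -mulrA [`|V| * _]mulrC.
- exact: cvg_cst.
- by rewrite -[X in _ --> X](mulr0 (n%:R * `|V|)); apply: cvgMr.
Unshelve. all: by end_near.
Qed.

Lemma power_stable_fix0 n p (M : 'M[R]_n) (V : 'M[R]_(n, p)) :
  power_stable M -> M *m V = V -> V = 0.
Proof.
move=> H HV; apply/matrixP => i j; rewrite [RHS]mxE.
have HVk k : M ^+ k *m V = V.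
  by elim: k => [|k IH]; rewrite ?expr0 ?mul1mx // exprSr -mulmxA HV IH.
have := @power_stable_mulmx_cvg _ _ M V i j H.
under eq_fun do rewrite HVk.
by move=> /cvg_lim; rewrite lim_cst //; apply.
Qed.
End Stability.

(** * Pointwise Lipschitz functions with pointwise Lipschitz derivatives *)

Section Calm.
Variables (R : realType) (V : normedModType R).
Implicit Types (f g : V -> R) (X : V).

(* Lipschitz with respect to the fixed base point [X] only. *)
Definition calm f X :=
  exists2 C : R, 0 <= C & \forall Y \near X, `|f Y - f X| <= C * `|Y - X|.

Lemma calm_cst (c : R) X : calm (cst c) X.
Proof. by exists 0 => //; near=> Y; rewrite subrr normr0 mul0r. Unshelve. all: by end_near. Qed.

Lemma calm_near f g X : (\forall Y \near X, f Y = g Y) -> calm f X -> calm g X.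
Proof.
move=> fg [C C0 HC]; exists C => //.
have fgX : f X = g X := nbhs_singleton fg.
by near=> Y; rewrite -fgX -(near fg Y) //; near: Y.
Unshelve. all: by end_near. Qed.

Lemma calmD f g X : calm f X -> calm g X -> calm (fun Y => f Y + g Y) X.
Proof.
move=> [C C0 HC] [D D0 HD]; exists (C + D); first exact: addr_ge0.
near=> Y; rewrite opprD addrACA mulrDl.
by apply: le_trans (ler_normD _ _) _; apply: lerD; near: Y.
Unshelve. all: by end_near. Qed.

Lemma calm_cvg f X : calm f X -> f Y @[Y --> X] --> f X.
Proof.
move=> [C C0 HC]; apply/cvgrPdist_lt => e e0.
(* [C] may be 0, so [e] is divided by [C + 1]. *)
have C1 : 0 < C + 1 by rewrite ltr_wpDl.
have HX : \forall Y \near X, `|X - Y| < e / (C + 1).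
  by have /cvgrPdist_lt := @cvg_id _ (nbhs X); apply; rewrite divr_gt0.
near=> Y; rewrite distrC.
apply: (@le_lt_trans _ _ (C * `|Y - X|)); first by near: Y.
apply: (@le_lt_trans _ _ ((C + 1) * `|Y - X|)); first by rewrite ler_wpM2r // lerDl.
rewrite -ltr_pdivlMl // mulrC distrC; near: Y.
Unshelve. all: by end_near. Qed.

Lemma calm_bounded f X : calm f X -> \forall Y \near X, `|f Y| <= `|f X| + 1.
Proof.
move=> /calm_cvg/cvgrPdist_lt /(_ 1 ltr01) H; near=> Y.
have : `|f X - f Y| < 1 by near: Y.
have : `|f Y| - `|f X| <= `|f Y - f X| by exact: lerB_dist.
by rewrite distrC; lra.
Unshelve. all: by end_near. Qed.

Lemma calmM f g X : calm f X -> calm g X -> calm (fun Y => f Y * g Y) X.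
Proof.
move=> cf cg; have [C C0 HC] := cf; have [D D0 HD] := cg.
exists (C * (`|g X| + 1) + `|f X| * D); first by rewrite addr_ge0 // mulr_ge0 // addr_ge0.
near=> Y.
have -> : f Y * g Y - f X * g X = (f Y - f X) * g Y + f X * (g Y - g X) by ring.
apply: le_trans (ler_normD _ _) _; rewrite !normrM mulrDl; apply: lerD.
  rewrite -mulrA [X in C * X]mulrC mulrA; apply: ler_pM => //; near: Y => //.
  exact: calm_bounded.
by rewrite -mulrA ler_wpM2l //; near: Y.
Unshelve. all: by end_near. Qed.

Lemma calm_neq0 f X : calm f X -> f X != 0 ->
  \forall Y \near X, `|f X| / 2 <= `|f Y|.
Proof.
move=> /calm_cvg/cvgrPdist_lt Hf fX.
have e0 : 0 < `|f X| / 2 by rewrite divr_gt0 // normr_gt0.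
have {}Hf := Hf _ e0; near=> Y.
have : `|f X - f Y| < `|f X| / 2 by near: Y.
have : `|f X| - `|f Y| <= `|f X - f Y| by exact: lerB_dist.
lra.
Unshelve. all: by end_near. Qed.

Lemma calmV f X : calm f X -> f X != 0 -> calm (fun Y => (f Y)^-1) X.
Proof.
move=> cf fX; have [C C0 HC] := cf; have fX0 : 0 < `|f X| by rewrite normr_gt0.
have HY := calm_neq0 cf fX.
(* Near [X] one has [|f Y| >= |f X| / 2], hence [1 / |f Y f X| <= 2 / |f X|^2]. *)
exists (C * (2 / (`|f X| * `|f X|))).
  by rewrite mulr_ge0 // divr_ge0 // mulr_ge0.
near=> Y.
have fY : `|f X| / 2 <= `|f Y| by near: Y.
have fY0 : 0 < `|f Y| by apply: lt_le_trans fY; rewrite divr_gt0.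
have nY : f Y != 0 by rewrite -normr_gt0.
have -> : (f Y)^-1 - (f X)^-1 = - (f Y - f X) * (f Y * f X)^-1 by field; rewrite fX nY.
rewrite normrM normrN mulrAC; apply: ler_pM => //; first by near: Y.
rewrite normfV normrM -[leRHS]invrK invf_div lef_pV2 ?posrE ?divr_gt0 ?mulr_gt0 //.
by rewrite mulrAC ler_wpM2r.
Unshelve. all: by end_near. Qed.

(* [derivable] is required near [X] because ['D_v f] is a total operator. *)
Definition calm1 f X := calm f X /\
  forall v, (\forall Y \near X, derivable f Y v) /\ calm ('D_v f) X.

(** Comparing derivatives at a point [Y] close to [X] requires equality on a neighbourhood of [Y],
    not only at [Y]. *)
Lemma near_nearE (S : V -> Prop) X :
  (\forall Y \near X, S Y) -> \forall Y \near X, \forall Z \near Y, S Z.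
Proof. by move=> H; apply: nbhs_interior. Qed.

Lemma near_derive f g X v : (\forall Y \near X, f Y = g Y) ->
  \forall Y \near X, 'D_v f Y = 'D_v g Y.
Proof.
move=> /near_nearE fg; near=> Y; by apply: near_eq_derive; near: Y.
Unshelve. all: by end_near. Qed.

Lemma calm1_near f g X : (\forall Y \near X, f Y = g Y) -> calm1 f X -> calm1 g X.
Proof.
move=> fg [cf df]; split=> [|v]; first exact: calm_near fg cf.
have [dfv cfv] := df v; split; last by apply: calm_near cfv; exact: near_derive.
have fgn := near_nearE fg.
near=> Y; apply: (@near_eq_derivable _ _ _ f); first by near: Y.
by near: Y.
Unshelve. all: by end_near. Qed.

Lemma calm1_cst (c : R) X : calm1 (cst c) X.
Proof.
split=> [|v]; first exact: calm_cst.
split; first by near=> Y; exact: derivable_cst.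
by have -> : 'D_v (cst c : V -> R) = cst 0; [apply/funext => Y; exact: derive_cst|exact: calm_cst].
Unshelve. all: by end_near. Qed.

Lemma calm1D f g X : calm1 f X -> calm1 g X -> calm1 (fun Y => f Y + g Y) X.
Proof.
move=> [cf df] [cg dg]; split=> [|v]; first exact: calmD.
have [dfv cfv] := df v; have [dgv cgv] := dg v; split.
  by apply: filterS2 dfv dgv => Y; exact: derivableD.
apply: calm_near (calmD cfv cgv); apply: filterS2 dfv dgv => Y d1 d2.
apply/esym; exact: deriveD.
Unshelve. all: by end_near. Qed.

Lemma calm1M f g X : calm1 f X -> calm1 g X -> calm1 (fun Y => f Y * g Y) X.
Proof.
move=> [cf df] [cg dg]; split=> [|v]; first exact: calmM.
have [dfv cfv] := df v; have [dgv cgv] := dg v; split.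
  by apply: filterS2 dfv dgv => Y; exact: derivableM.
apply: calm_near (calmD (calmM cf cgv) (calmM cg cfv)); apply: filterS2 dfv dgv => Y d1 d2.
apply/esym; exact: deriveM.
Unshelve. all: by end_near. Qed.

Lemma calm1V f X : calm1 f X -> f X != 0 -> calm1 (fun Y => (f Y)^-1) X.
Proof.
move=> [cf df] fX; split=> [|v]; first exact: calmV.
have fX0 : 0 < `|f X| by rewrite normr_gt0.
have fn0 : \forall Y \near X, f Y != 0.
  have H := calm_neq0 cf fX; near=> Y.
  by rewrite -normr_gt0; apply: (@lt_le_trans _ _ (`|f X| / 2)); [lra|near: Y].
have [dfv cfv] := df v; split.
  by near=> Y; apply: (@derivableV _ _ f); near: Y.
have cV := calmV cf fX.
apply: calm_near (calmM (calmM (calm_cst (-1) X) (calmM cV cV)) cfv).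
near=> Y; rewrite (@deriveV _ _ f); [|by near: Y|by near: Y].
by rewrite /= mulN1r expr2 invfM.
Unshelve. all: by end_near. Qed.

Lemma calm1N f X : calm1 f X -> calm1 (fun Y => - f Y) X.
Proof.
move=> H; apply: calm1_near (calm1M (calm1_cst (-1) X) H).
by near=> Y; rewrite /= mulN1r.
Unshelve. all: by end_near. Qed.

Lemma calm1B f g X : calm1 f X -> calm1 g X -> calm1 (fun Y => f Y - g Y) X.
Proof. by move=> H1 H2; apply: calm1D => //; exact: calm1N. Qed.

Lemma calm1_sum (I : Type) (s : seq I) (S : pred I) (f : I -> V -> R) X :
  (forall i, S i -> calm1 (f i) X) -> calm1 (fun Y => \sum_(i <- s | S i) f i Y) X.
Proof.
move=> H; elim: s => [|i s IH].
  by under eq_fun do rewrite big_nil; exact: calm1_cst.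
under eq_fun do rewrite big_cons.
by case E : (S i) => //; apply: calm1D => //; exact: H.
Qed.

Lemma calm1_prod (I : Type) (s : seq I) (S : pred I) (f : I -> V -> R) X :
  (forall i, S i -> calm1 (f i) X) -> calm1 (fun Y => \prod_(i <- s | S i) f i Y) X.
Proof.
move=> H; elim: s => [|i s IH].
  by under eq_fun do rewrite big_nil; exact: calm1_cst.
under eq_fun do rewrite big_cons.
by case E : (S i) => //; apply: calm1M => //; exact: H.
Qed.

(** A linear function has the constant [f v] as its derivative along [v], since its difference
    quotient does not depend on the nonzero increment [h]. *)
Lemma calm1_linear f (C : R) X : 0 <= C ->
  (forall (h : R) Y Z, f (h *: Y + Z) = h * f Y + f Z) ->
  (forall Y, `|f Y| <= C * `|Y|) -> calm1 f X.
Proof.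
move=> C0 fl HC; split=> [|v].
  exists C => //; near=> Y.
  by rewrite [f Y - _]addrC -mulN1r -fl scaleN1r addrC; exact: HC.
have Hd Y : is_derive Y v (f : V -> R) (f v).
  have Hl : (fun h : R => h^-1 *: (((f : V -> R) \o shift Y) (h *: v) - f Y)) @ 0^' --> (f v : R).
    apply: (@cvg_trans _ (cst (f v : R) @ 0^')); last exact: cvg_cst.
    apply: near_eq_cvg; near=> h => /=.
    rewrite fl addrK -[_ *: _]/(_ * _) mulrA mulVf ?mul1r //.
    by near: h; exact: nbhs_dnbhs_neq.
  by apply: DeriveDef; [apply/cvg_ex; exists (f v)|exact: cvg_lim Hl].
split; first by near=> Y; case: (Hd Y).
suff -> : 'D_v (f : V -> R) = cst (f v) by exact: calm_cst.
by apply/funext => Y; exact: derive_val.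
Unshelve. all: by end_near. Qed.

End Calm.

(** * Matrix operations preserving [calm1] entries *)

Section NiceMatrix.
Variables (R : realType) (V : normedModType R).
Implicit Types X : V.

Definition calm1_mx p q (F : V -> 'M[R]_(p, q)) X :=
  forall i j, calm1 (fun Y => F Y i j) X.

Lemma calm1_mx_cst p q (M : 'M[R]_(p, q)) X : calm1_mx (cst M) X.
Proof. by move=> i j; exact: calm1_cst. Qed.

Lemma calm1_mxD p q (F G : V -> 'M[R]_(p, q)) X :
  calm1_mx F X -> calm1_mx G X -> calm1_mx (fun Y => F Y + G Y) X.
Proof. by move=> HF HG i j; under eq_fun do rewrite mxE; exact: calm1D. Qed.

Lemma calm1_mxN p q (F : V -> 'M[R]_(p, q)) X :
  calm1_mx F X -> calm1_mx (fun Y => - F Y) X.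
Proof. by move=> HF i j; under eq_fun do rewrite mxE; exact: calm1N. Qed.

Lemma calm1_mxT p q (F : V -> 'M[R]_(p, q)) X :
  calm1_mx F X -> calm1_mx (fun Y => (F Y)^T) X.
Proof. by move=> HF i j; under eq_fun do rewrite mxE. Qed.

Lemma calm1_mxM p q s (F : V -> 'M[R]_(p, q)) (G : V -> 'M[R]_(q, s)) X :
  calm1_mx F X -> calm1_mx G X -> calm1_mx (fun Y => F Y *m G Y) X.
Proof.
move=> HF HG i j; under eq_fun do rewrite mxE.
by apply: calm1_sum => k _; exact: calm1M.
Qed.

Lemma calm1_mxX p (F : V -> 'M[R]_p) k X :
  calm1_mx F X -> calm1_mx (fun Y => F Y ^+ k) X.
Proof.
move=> HF; elim: k => [|k IH]; first exact: calm1_mx_cst.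
by under eq_fun do rewrite exprS; exact: calm1_mxM.
Qed.

Lemma calm1_det p (F : V -> 'M[R]_p) X :
  calm1_mx F X -> calm1 (fun Y => \det (F Y)) X.
Proof.
move=> HF; apply: calm1_sum => s _; apply: calm1M; first exact: calm1_cst.
by apply: calm1_prod => i _; exact: HF.
Qed.

Lemma calm1_adj p (F : V -> 'M[R]_p) X :
  calm1_mx F X -> calm1_mx (fun Y => \adj (F Y)) X.
Proof.
move=> HF i j; under eq_fun do rewrite mxE; apply: calm1M; first exact: calm1_cst.
by apply: calm1_det => a b; under eq_fun do rewrite !mxE; exact: HF.
Qed.

Lemma near_unitmx p (F : V -> 'M[R]_p) X :
  calm1_mx F X -> F X \in unitmx -> \forall Y \near X, F Y \in unitmx.
Proof.
move=> /calm1_det [cd _]; rewrite unitmxE unitfE => d0.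
have H := calm_neq0 cd d0; near=> Y; rewrite unitmxE unitfE -normr_gt0.
apply: (@lt_le_trans _ _ (`|\det (F X)| / 2)); last by near: Y.
by rewrite divr_gt0 // normr_gt0.
Unshelve. all: by end_near. Qed.

Lemma calm1_invmx p (F : V -> 'M[R]_p) X :
  calm1_mx F X -> F X \in unitmx -> calm1_mx (fun Y => invmx (F Y)) X.
Proof.
move=> HF uX i j; have HU := near_unitmx HF uX.
(* [invmx] returns its argument on singular matrices, so Cramer's formula is available only near
   [X], where the determinant stays nonzero. *)
apply: (@calm1_near _ _ (fun Y => (\det (F Y))^-1 * (\adj (F Y)) i j)).
  by apply: filterS HU => Y uY; rewrite /invmx uY [RHS]mxE.
apply: calm1M; last exact: calm1_adj.
by apply: calm1V; [exact: calm1_det|rewrite -unitfE -unitmxE].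
Unshelve. all: by end_near. Qed.

Lemma calm1_mx_near_norm p q (F : V -> 'M[R]_(p, q)) X (e : R) :
  calm1_mx F X -> `|F X| < e -> \forall Y \near X, `|F Y| <= e.
Proof.
move=> HF He; have e0 : 0 < e - `|F X| by rewrite subr_gt0.
have H i j : \forall Y \near X, `|F Y i j| <= e.
  have /calm_cvg/cvgrPdist_lt/(_ _ e0) Hc := (HF i j).1.
  near=> Y; have : `|F X i j - F Y i j| < e - `|F X| by near: Y.
  have := @normr_entry_le _ _ _ (F X) i j.
  have := lerB_dist (F Y i j) (F X i j); rewrite distrC; lra.
have {}H : \forall Y \near X, forall ij : 'I_p * 'I_q, `|F Y ij.1 ij.2| <= e.
  by apply: filter_forall => ij; exact: H.
near=> Y; apply: normr_mx_le; first by apply: le_trans (ltW He).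
by move=> i j; apply: (near H Y _ (i, j)).
Unshelve. all: by end_near. Qed.

End NiceMatrix.

Section NiceCoord.
Variables (R : realType) (p q : nat).

Lemma calm1_mx_id (X : 'M[R]_(p, q)) : calm1_mx id X.
Proof.
move=> i j; apply: (@calm1_linear _ _ (fun Y : 'M[R]_(p, q) => Y i j) 1) => // [h Y Z|Y].
  by rewrite !mxE.
by rewrite mul1r normr_entry_le.
Qed.

End NiceCoord.

(** * Stability as an open condition, and invertibility of [1 - M] *)

Section NearStable.
Variables (R : realType) (V : normedModType R).

(** Some power of [F X] is small; the same power of [F Y] is small for [Y] near [X] by continuity,
    and that already forces stability. *)
Lemma near_power_stable n (F : V -> 'M[R]_n) X : calm1_mx F X ->
  power_stable (F X) -> \forall Y \near X, power_stable (F Y).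
Proof.
(* Chosen so that [n e <= 1/2], with [n.+1] in place of [n] to avoid dividing by 0. *)
move=> HF HX; pose e : R := 2^-1 / n.+1%:R.
have e0 : 0 < e by rewrite divr_gt0 ?invr_gt0.
have [k k0 Hk] := power_stable_contracts e0 HX.
have := calm1_mx_near_norm (calm1_mxX k HF) Hk.
apply: filterS => Y HY; apply: (power_stable_contraction k0).
apply: le_trans (_ : n.+1%:R * e <= _); last by rewrite /e mulrCA divff ?mulr1.
by apply: ler_pM => //; rewrite ler_nat.
Qed.

Lemma power_stable_unitmx n (M : 'M[R]_n) : power_stable M -> 1%:M - M \in unitmx.
Proof.
(* [kermx] is a left kernel: after transposition its rows become columns fixed by [M], which vanish
   by [power_stable_fix0]. *)
move=> H; rewrite -unitmx_tr -row_free_unit -kermx_eq0; apply/eqP/trmx_inj; rewrite trmx0.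
apply: (power_stable_fix0 H); apply/esym/eqP; rewrite -subr_eq0 -[X in X - _]mul1mx.
by rewrite -mulmxBl -trmx_eq0 trmx_mul trmxK mulmx_ker.
Qed.

End NearStable.

(** * Square-integrable random variables *)

Section SquareIntegrable.
Context d (T : measurableType d) (R : realType) (P : probability T R).
Implicit Types f g : T -> R.

Definition L1 f := P.-integrable setT (EFin \o f).
(** Measurability is a separate clause because that of the square does not imply that of [f]. *)
Definition L2 f := measurable_fun setT f /\ L1 (fun o => f o ^+ 2).
Definition Ex f : R := fine 'E_P[f].

Lemma L1_cst (c : R) : L1 (fun=> c).
Proof. exact: finite_measure_integrable_cst. Qed.

Lemma L1D f g : L1 f -> L1 g -> L1 (fun o => f o + g o).
Proof. by move=> Hf Hg; exact: (@integrableD _ _ _ _ _ measurableT (EFin \o f) (EFin \o g)). Qed.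

Lemma L1Z (c : R) f : L1 f -> L1 (fun o => c * f o).
Proof. by move=> Hf; exact: (integrableZl measurableT c Hf). Qed.

Lemma L1_sum (I : Type) (s : seq I) (f : I -> T -> R) :
  (forall i, L1 (f i)) -> L1 (fun o => \sum_(i <- s) f i o).
Proof.
move=> H; elim: s => [|i s IH].
  by under eq_fun do rewrite big_nil; exact: L1_cst.
by under eq_fun do rewrite big_cons; exact: L1D.
Qed.

Lemma Ex_EFin f : L1 f -> (Ex f)%:E = (\int[P]_o (f o)%:E)%E.
Proof. by move=> Hf; rewrite /Ex unlock fineK //; exact: integrable_fin_num. Qed.

Lemma Ex_cst (c : R) : Ex (fun=> c) = c.
Proof. by rewrite /Ex expectation_cst. Qed.

Lemma ExD f g : L1 f -> L1 g -> Ex (fun o => f o + g o) = Ex f + Ex g.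
Proof.
move=> Hf Hg; apply: EFin_inj; rewrite EFinD !Ex_EFin //; last exact: L1D.
by under eq_integral do rewrite EFinD; rewrite integralD.
Qed.

Lemma ExZ (c : R) f : L1 f -> Ex (fun o => c * f o) = c * Ex f.
Proof.
move=> Hf; apply: EFin_inj; rewrite EFinM !Ex_EFin //; last exact: L1Z.
by under eq_integral do rewrite EFinM; rewrite integralZl.
Qed.

Lemma Ex_sum (I : Type) (s : seq I) (f : I -> T -> R) :
  (forall i, L1 (f i)) -> Ex (fun o => \sum_(i <- s) f i o) = \sum_(i <- s) Ex (f i).
Proof.
move=> H; elim: s => [|i s IH].
  by under eq_fun do rewrite big_nil; rewrite Ex_cst big_nil.
by under eq_fun do rewrite big_cons; rewrite ExD //; [rewrite big_cons IH|exact: L1_sum].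
Qed.

Lemma Ex_ge0 f : (forall o, 0 <= f o) -> 0 <= Ex f.
Proof. by move=> Hf; rewrite /Ex fine_ge0 // expectation_ge0. Qed.

Lemma le_Ex f g : L1 f -> L1 g -> (forall o, f o <= g o) -> Ex f <= Ex g.
Proof.
move=> Hf Hg H; rewrite -subr_ge0 -[X in - X]mul1r -mulNr -ExZ // -ExD //; last exact: L1Z.
by apply: Ex_ge0 => o; rewrite mulN1r subr_ge0.
Qed.

Lemma L1_dominated f g : measurable_fun setT f -> L1 g ->
  (forall o, `|f o| <= g o) -> L1 f.
Proof.
move=> mf Hg H; apply: (le_integrable measurableT _ _ Hg).
  exact/measurable_EFinP.
by move=> o _ /=; rewrite lee_fin; apply: le_trans (H o) _; exact: ler_norm.
Qed.

(** Constants are integrable for a probability measure, and [(|f| - 1)^2 >= 0] bounds [|f|] by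
    [1 + f^2]. *)
Lemma L2_L1 f : L2 f -> L1 f.
Proof.
move=> [mf f2]; apply: (L1_dominated mf (L1D (L1_cst 1) f2)) => o.
have := sqr_ge0 (`|f o| - 1); rewrite -[f o ^+ 2]real_normK ?num_real //; nra.
Qed.

Lemma L2M_L1 f g : L2 f -> L2 g -> L1 (fun o => f o * g o).
Proof.
move=> [mf f2] [mg g2]; apply: (L1_dominated _ (L1D f2 g2)).
  exact: measurable_funM.
move=> o; rewrite normrM -[f o ^+ 2]real_normK ?num_real // -[g o ^+ 2]real_normK ?num_real //.
have := sqr_ge0 (`|f o| - `|g o|); have := normr_ge0 (f o); have := normr_ge0 (g o); nra.
Qed.

Lemma L2_cst (c : R) : L2 (fun=> c).
Proof. by split; [exact: measurable_cst|exact: L1_cst]. Qed.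

Lemma L2D f g : L2 f -> L2 g -> L2 (fun o => f o + g o).
Proof.
move=> Hf Hg; have fg := L2M_L1 Hf Hg; case: Hf Hg => mf f2 [mg g2].
split; first exact: measurable_funD.
suff -> : (fun o => (f o + g o) ^+ 2) = (fun o => f o ^+ 2 + (2 * (f o * g o) + g o ^+ 2)).
  by apply: L1D => //; apply: L1D => //; exact: L1Z.
by apply/funext => o; ring.
Qed.

Lemma L2Z (c : R) f : L2 f -> L2 (fun o => c * f o).
Proof.
move=> [mf f2]; split; first by apply: measurable_funM => //; exact: measurable_cst.
by under eq_fun do rewrite exprMn; exact: L1Z.
Qed.

Lemma L2_sum (I : Type) (s : seq I) (f : I -> T -> R) :
  (forall i, L2 (f i)) -> L2 (fun o => \sum_(i <- s) f i o).
Proof.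
move=> H; elim: s => [|i s IH].
  by under eq_fun do rewrite big_nil; exact: L2_cst.
by under eq_fun do rewrite big_cons; exact: L2D.
Qed.

(** A crude substitute for Cauchy-Schwarz, read off from [(f + g)^2 >= 0] and [(f - g)^2 >= 0]; it
    serves only to keep cross moments bounded. *)
Lemma normr_ExM_le f g : L2 f -> L2 g ->
  `|Ex (fun o => f o * g o)| <= Ex (fun o => f o ^+ 2) + Ex (fun o => g o ^+ 2).
Proof.
move=> Hf Hg; have fg := L2M_L1 Hf Hg; case: Hf Hg => mf f2 [mg g2].
rewrite -ExD // ler_norml -[X in X <= _]mulN1r -ExZ //; last exact: L1D.
apply/andP; split; apply: le_Ex => //; try (by apply: L1Z; exact: L1D); try exact: L1D.
- move=> o; have := sqr_ge0 (f o + g o); have := sqr_ge0 (f o); have := sqr_ge0 (g o); nra.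
- move=> o; have := sqr_ge0 (f o - g o); have := sqr_ge0 (f o); have := sqr_ge0 (g o); nra.
Qed.

(** Independence says that the joint law [m12] agrees with the product of the marginals on
    rectangles, hence everywhere; Fubini then factors the integral of [z.1 * z.2]. *)
Lemma Ex_indep f g : L2 f -> L2 g ->
  (forall A B : set R, measurable A -> measurable B ->
    P (f @^-1` A `&` g @^-1` B) = (P (f @^-1` A) * P (g @^-1` B))%E) ->
  Ex (fun o => f o * g o) = Ex f * Ex g.
Proof.
move=> Hf Hg Hi; have fg1 := L2M_L1 Hf Hg.
have f1 := L2_L1 Hf; have g1 := L2_L1 Hg.
have mf := Hf.1; have mg := Hg.1.
pose F : {mfun T >-> R} := HB.pack f (isMeasurableFun.Build _ _ _ _ f mf).
pose G : {mfun T >-> R} := HB.pack g (isMeasurableFun.Build _ _ _ _ g mg).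
have mfg : measurable_fun setT (fun o => (f o, g o)) by exact: measurable_fun_pair.
pose FG : {mfun T >-> (R * R)%type} :=
  HB.pack (fun o => (f o, g o)) (isMeasurableFun.Build _ _ _ _ (fun o => (f o, g o)) mfg).
pose m1 := distribution P F; pose m2 := distribution P G.
pose m12 := distribution P FG.
pose h (z : R * R) := (z.1 * z.2)%:E.
have mh : measurable_fun setT h.
  by apply/measurable_EFinP; apply: measurable_funM; [exact: measurable_fst|exact: measurable_snd].
have HmT A : measurable A -> A `<=` setT -> (m1 \x m2)%E A = m12 A.
  by move=> mA _; exact: product_measure_unique.
have HI (k : R * R -> \bar R) : (\int[m1 \x m2]_z k z = \int[m12]_z k z)%E.
  exact: eq_measure_integral.
have hP : P.-integrable setT (h \o FG) by exact: fg1.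
have h12 : m12.-integrable setT h.
  exact: (@integrable_pushforward _ _ _ _ _ _ mfg P setT h mh hP measurableT).
(* Integrability for the product measure, needed by Fubini, is transferred from the joint law, where
   it comes from that of [f * g]. *)
have hprod : (m1 \x m2)%E.-integrable setT h.
  apply/integrableP; split => //; case/integrableP: h12 => _.
  by rewrite HI.
apply: EFin_inj; rewrite EFinM !Ex_EFin //.
have -> : (\int[P]_o (f o * g o)%:E = \int[m12]_z h z)%E.
  by rewrite (@integral_distribution _ _ _ _ _ P FG).
have -> : (\int[P]_o (f o)%:E = \int[m1]_x x%:E)%E.
  by rewrite (@integral_distribution _ _ _ _ _ P F (@EFin R)) //.
have m2E : (\int[P]_o (g o)%:E = \int[m2]_x x%:E)%E.
  by rewrite (@integral_distribution _ _ _ _ _ P G (@EFin R)) //.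
rewrite m2E -HI.
have mE : measurable_fun [set: R] (@EFin R) by [].
have i2 : m2.-integrable setT (@EFin R).
  exact: (@integrable_pushforward _ _ _ _ _ _ mg P setT (@EFin R) mE g1 measurableT).
have i1 : m1.-integrable setT (@EFin R).
  exact: (@integrable_pushforward _ _ _ _ _ _ mf P setT (@EFin R) mE f1 measurableT).
rewrite -(integral12_prod_meas1 hprod) /fubini_F /=.
transitivity (\int[m1]_x (x%:E * \int[m2]_y y%:E))%E.
  by apply: eq_integral => x _; rewrite -integralZl.
(* The inner integral must be displayed as a real constant before it can leave the outer one. *)
have /fineK <- : (\int[m2]_x x%:E)%E \is a fin_num by exact: integrable_fin_num.
by rewrite integralZr.
Qed.
End SquareIntegrable.

(** * Limits of matrices and cross moments *)

Section MatrixLimits.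
Variable R : realType.

Definition mcvg p q (U : nat -> 'M[R]_(p, q)) (M : 'M[R]_(p, q)) :=
  forall i j, (fun t => U t i j) @ \oo --> (M i j : R).

Lemma mcvg_cst p q (M : 'M[R]_(p, q)) : mcvg (fun=> M) M.
Proof. by move=> i j; exact: cvg_cst. Qed.

Lemma mcvgD p q (U V : nat -> 'M[R]_(p, q)) M N :
  mcvg U M -> mcvg V N -> mcvg (fun t => U t + V t) (M + N).
Proof. by move=> HU HV i j; rewrite mxE; under eq_fun do rewrite mxE; exact: cvgD. Qed.

Lemma mcvgN p q (U : nat -> 'M[R]_(p, q)) M : mcvg U M -> mcvg (fun t => - U t) (- M).
Proof. by move=> HU i j; rewrite mxE; under eq_fun do rewrite mxE; exact: cvgN. Qed.

Lemma mcvgT p q (U : nat -> 'M[R]_(p, q)) M : mcvg U M -> mcvg (fun t => (U t)^T) M^T.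
Proof. by move=> HU i j; rewrite mxE; under eq_fun do rewrite mxE; exact: HU. Qed.

Lemma cvg_sum_seq (I : Type) (s : seq I) (f : I -> nat -> R) (l : I -> R) :
  (forall i, f i @ \oo --> l i) ->
  (fun t => \sum_(i <- s) f i t) @ \oo --> \sum_(i <- s) l i.
Proof.
move=> H; elim: s => [|i s IH].
  by rewrite big_nil; under eq_fun do rewrite big_nil; exact: cvg_cst.
by rewrite big_cons; under eq_fun do rewrite big_cons; exact: cvgD.
Qed.

Lemma mcvgM p q s (U : nat -> 'M[R]_(p, q)) (V : nat -> 'M[R]_(q, s)) M N :
  mcvg U M -> mcvg V N -> mcvg (fun t => U t *m V t) (M *m N).
Proof.
move=> HU HV i j; rewrite mxE; under eq_fun do rewrite mxE.
by apply: cvg_sum_seq => k; exact: cvgM.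
Qed.

(* Only a convergent bound on [V] is assumed: this is what disposes of the
   correlations between the initial state and the noise. *)
Lemma mcvg0_mul p q s (U : nat -> 'M[R]_(p, q)) (V : nat -> 'M[R]_(q, s))
    (B : 'I_q -> 'I_s -> nat -> R) (b : 'I_q -> 'I_s -> R) :
  mcvg U 0 -> (forall i j t, `|V t i j| <= B i j t) ->
  (forall i j, B i j @ \oo --> b i j) -> mcvg (fun t => U t *m V t) 0.
Proof.
move=> HU HV HB i j; rewrite mxE; under eq_fun do rewrite mxE.
suff : (fun t => \sum_k U t i k * V t k j) @ \oo --> \sum_(k < q) (0 : R) by rewrite big1.
apply: cvg_sum_seq => k.
suff Hn : (fun t => `|U t i k * V t k j|) @ \oo --> (0 : R) by exact: norm_cvg0 Hn.
apply: (@squeeze_cvgr _ _ _ _ (cst 0) (fun t => `|U t i k| * B k j t)).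
- by near=> t; rewrite /= normr_ge0 /= normrM ler_wpM2l.
- exact: cvg_cst.
- rewrite -[X in _ --> X](mul0r (b k j)); apply: cvgM => //.
  have H0 : (fun t => `|U t i k|) @ \oo --> `|(0 : 'M[R]_(p, q)) i k|.
    by apply: cvg_norm; exact: HU.
  by rewrite mxE normr0 in H0.
Unshelve. all: by end_near.
Qed.

Lemma mcvg_tr p (U : nat -> 'M[R]_p) M : mcvg U M -> (fun t => \tr (U t)) @ \oo --> \tr M.
Proof. by move=> HU; apply: cvg_sum_seq => i; exact: HU. Qed.

Lemma power_stable_mcvg n (M : 'M[R]_n) : power_stable M -> mcvg (fun k => M ^+ k) 0.
Proof.
move=> H i j; rewrite mxE; under eq_fun do rewrite -[M ^+ _]mulmx1.
exact: power_stable_mulmx_cvg.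
Qed.

End MatrixLimits.
Arguments mcvg_cst {R p q} M.

(** * First and second moments of random vectors *)

Section RandomVectors.
Context d (T : measurableType d) (R : realType) (P : probability T R).

Definition L1mx p q (X : T -> 'M[R]_(p, q)) := forall i j, L1 P (fun o => X o i j).
Definition L2mx p q (X : T -> 'M[R]_(p, q)) := forall i j, L2 P (fun o => X o i j).

Lemma L2mx_L1mx p q (X : T -> 'M[R]_(p, q)) : L2mx X -> L1mx X.
Proof. by move=> H i j; exact: L2_L1. Qed.

Lemma L1mxD p q (X Y : T -> 'M[R]_(p, q)) : L1mx X -> L1mx Y -> L1mx (fun o => X o + Y o).
Proof. by move=> HX HY i j; under eq_fun do rewrite mxE; exact: L1D. Qed.

Lemma L1mx_cst p q (M : 'M[R]_(p, q)) : L1mx (fun=> M).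
Proof. by move=> i j; exact: L1_cst. Qed.

Lemma L2mx_cst p q (M : 'M[R]_(p, q)) : L2mx (fun=> M).
Proof. by move=> i j; exact: L2_cst. Qed.

Lemma L2mxD p q (X Y : T -> 'M[R]_(p, q)) : L2mx X -> L2mx Y -> L2mx (fun o => X o + Y o).
Proof. by move=> HX HY i j; under eq_fun do rewrite mxE; exact: L2D. Qed.

Lemma L2mx_mulmxl p q s (M : 'M[R]_(s, p)) (X : T -> 'M[R]_(p, q)) :
  L2mx X -> L2mx (fun o => M *m X o).
Proof.
by move=> HX i j; under eq_fun do rewrite mxE; apply: L2_sum => k; exact: L2Z.
Qed.

Lemma L1mx_mulmxl p q s (M : 'M[R]_(s, p)) (X : T -> 'M[R]_(p, q)) :
  L1mx X -> L1mx (fun o => M *m X o).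
Proof.
by move=> HX i j; under eq_fun do rewrite mxE; apply: L1_sum => k; exact: L1Z.
Qed.

Lemma L2mx_outer p q (X : T -> 'cV[R]_p) (Y : T -> 'cV[R]_q) :
  L2mx X -> L2mx Y -> L1mx (fun o => X o *m (Y o)^T).
Proof.
move=> HX HY i j; under eq_fun do rewrite mxE big_ord1 mxE; exact: L2M_L1.
Qed.

Lemma mx_expectationD p q (X Y : T -> 'M[R]_(p, q)) : L1mx X -> L1mx Y ->
  mx_expectation P (fun o => X o + Y o) = mx_expectation P X + mx_expectation P Y.
Proof.
move=> HX HY; apply/matrixP => i j; rewrite !mxE.
by under eq_fun do rewrite mxE; exact: ExD.
Qed.

Lemma mx_expectation_cst p q (M : 'M[R]_(p, q)) : mx_expectation P (fun=> M) = M.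
Proof. by apply/matrixP => i j; rewrite !mxE; exact: Ex_cst. Qed.

Lemma mx_expectation_mulmxl p q s (M : 'M[R]_(s, p)) (X : T -> 'M[R]_(p, q)) :
  L1mx X -> mx_expectation P (fun o => M *m X o) = M *m mx_expectation P X.
Proof.
move=> HX; apply/matrixP => i j; rewrite !mxE.
under eq_fun do rewrite mxE.
have -> : (fun o => \sum_k M i k * X o k j) = (fun o => \sum_k (fun k o => M i k * X o k j) k o) by [].
rewrite -/(Ex P _) Ex_sum => [|k]; last exact: L1Z.
by apply: eq_bigr => k _; rewrite ExZ // mxE.
Qed.

Definition cross p q (X : T -> 'cV[R]_p) (Y : T -> 'cV[R]_q) : 'M[R]_(p, q) :=
  mx_expectation P (fun o => X o *m (Y o)^T).

Lemma cross_tr p q (X : T -> 'cV[R]_p) (Y : T -> 'cV[R]_q) : (cross X Y)^T = cross Y X.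
Proof.
apply/matrixP => i j; rewrite !mxE; congr (fine ('E_P[ _ ])%E); apply/funext => o.
by rewrite !mxE; apply: eq_bigr => k _; rewrite !mxE mulrC.
Qed.

Lemma crossDl p q (X X' : T -> 'cV[R]_p) (Y : T -> 'cV[R]_q) :
  L2mx X -> L2mx X' -> L2mx Y ->
  cross (fun o => X o + X' o) Y = cross X Y + cross X' Y.
Proof.
move=> HX HX' HY; rewrite /cross; under eq_fun do rewrite mulmxDl.
by rewrite mx_expectationD //; exact: L2mx_outer.
Qed.

Lemma crossMl p q s (M : 'M[R]_(s, p)) (X : T -> 'cV[R]_p) (Y : T -> 'cV[R]_q) :
  L2mx X -> L2mx Y -> cross (fun o => M *m X o) Y = M *m cross X Y.
Proof.
move=> HX HY; rewrite /cross; under eq_fun do rewrite -mulmxA.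
by rewrite mx_expectation_mulmxl //; exact: L2mx_outer.
Qed.

Lemma cross_cstl p q (c : 'cV[R]_p) (Y : T -> 'cV[R]_q) :
  L2mx Y -> cross (fun=> c) Y = c *m (mean_vec P Y)^T.
Proof.
move=> HY; rewrite /cross mx_expectation_mulmxl.
  congr (_ *m _); apply/matrixP => i j; rewrite !mxE.
  by under eq_fun do rewrite mxE.
by move=> i j; under eq_fun do rewrite mxE; exact: L2_L1.
Qed.

Lemma crossDr p q (X : T -> 'cV[R]_p) (Y Y' : T -> 'cV[R]_q) :
  L2mx X -> L2mx Y -> L2mx Y' ->
  cross X (fun o => Y o + Y' o) = cross X Y + cross X Y'.
Proof. by move=> *; rewrite -cross_tr crossDl // linearD /= !cross_tr. Qed.

Lemma crossMr p q s (M : 'M[R]_(s, q)) (X : T -> 'cV[R]_p) (Y : T -> 'cV[R]_q) :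
  L2mx X -> L2mx Y -> cross X (fun o => M *m Y o) = cross X Y *m M^T.
Proof. by move=> *; rewrite -cross_tr crossMl // trmx_mul cross_tr. Qed.

Lemma cross_cstr p q (X : T -> 'cV[R]_p) (c : 'cV[R]_q) :
  L2mx X -> cross X (fun=> c) = mean_vec P X *m c^T.
Proof. by move=> *; rewrite -cross_tr cross_cstl // trmx_mul trmxK. Qed.

Lemma cross_bound p q (X : T -> 'cV[R]_p) (Y : T -> 'cV[R]_q) i j :
  L2mx X -> L2mx Y -> `|cross X Y i j| <= cross X X i i + cross Y Y j j.
Proof.
move=> HX HY; rewrite !mxE; under eq_fun do rewrite mxE big_ord1 mxE.
under [X in _ <= fine 'E_P[X] + _]eq_fun do rewrite mxE big_ord1 mxE -expr2.
under [X in _ <= _ + fine 'E_P[X]]eq_fun do rewrite mxE big_ord1 mxE -expr2.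
exact: normr_ExM_le.
Qed.

(** Cyclicity of the trace makes a quadratic cost linear in [x x^T], so its expectation depends on
    the second moment alone. *)
Lemma quad_form_outer p (M : 'M[R]_p) (x : 'cV[R]_p) : quad_form M x = \tr (M *m (x *m x^T)).
Proof. by rewrite /quad_form mulmxA mxtrace_mulC mulmxA [in RHS]/mxtrace big_ord1. Qed.

Lemma Ex_trace p (X : T -> 'M[R]_p) : L1mx X ->
  Ex P (fun o => \tr (X o)) = \tr (mx_expectation P X).
Proof.
move=> HX; rewrite /mxtrace Ex_sum //; by apply: eq_bigr => i _; rewrite mxE.
Qed.

Lemma L1_quad_form p (M : 'M[R]_p) (X : T -> 'cV[R]_p) : L2mx X ->
  L1 P (fun o => quad_form M (X o)).
Proof.
move=> HX; under eq_fun do rewrite quad_form_outer.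
by apply: L1_sum => i; apply: L1mx_mulmxl; exact: L2mx_outer.
Qed.

Lemma Ex_quad_form p (M : 'M[R]_p) (X : T -> 'cV[R]_p) : L2mx X ->
  Ex P (fun o => quad_form M (X o)) = \tr (M *m cross X X).
Proof.
move=> HX; under eq_fun do rewrite quad_form_outer.
rewrite Ex_trace; last by apply: L1mx_mulmxl; exact: L2mx_outer.
by rewrite mx_expectation_mulmxl //; exact: L2mx_outer.
Qed.

Lemma dot_trE p (x S : 'cV[R]_p) : (x^T *m S) 0 0 = (S^T *m x) 0 0.
Proof. by rewrite !mxE; apply: eq_bigr => k _; rewrite !mxE mulrC. Qed.

Lemma Ex_dot p (S : 'cV[R]_p) (X : T -> 'cV[R]_p) : L2mx X ->
  Ex P (fun o => ((X o)^T *m S) 0 0) = ((mean_vec P X)^T *m S) 0 0.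
Proof.
move=> /L2mx_L1mx HX; under eq_fun do rewrite dot_trE.
rewrite dot_trE -/(mean_vec P X) -mx_expectation_mulmxl //.
by rewrite mxE.
Qed.

Lemma L1_dot p (S : 'cV[R]_p) (X : T -> 'cV[R]_p) : L2mx X ->
  L1 P (fun o => ((X o)^T *m S) 0 0).
Proof.
move=> /L2mx_L1mx HX; under eq_fun do rewrite dot_trE.
exact: L1mx_mulmxl.
Qed.

End RandomVectors.

(** * Stationary mean, covariance and cost *)

Section Response.
Variables (R : realType) (n : nat).
Implicit Types (F V W : 'M[R]_n) (v : nat -> 'cV[R]_n).

(** The zero initial value makes the response additive in the input, which lets the constant drift
    and the centered noise be treated separately. *)
Fixpoint response F v t : 'cV[R]_n :=
  if t is s.+1 then F *m response F v s + v s else 0.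

Lemma responseD F v v' t :
  response F (fun s => v s + v' s) t = response F v t + response F v' t.
Proof.
elim: t => [|t IH] /=; first by rewrite addr0.
by rewrite IH mulmxDr addrACA.
Qed.

Lemma state_response m (A : 'M[R]_n) (B : 'M[R]_(n, m)) X x0 v t :
  let F := A - B *m lsubmx X in
  state A B X x0 v t = F ^+ t *m x0 + response F (fun s => B *m rsubmx X + v s) t.
Proof.
move=> F; elim: t => [|t IH] /=; first by rewrite expr0 mul1mx addr0.
have Hx (x : 'cV_n) : A *m x + B *m control X x + v t = F *m x + (B *m rsubmx X + v t).
  by rewrite /F /control mulmxBl mulmxDr mulNmx mulmxN mulmxA !addrA.
by rewrite Hx IH mulmxDr mulmxA mulmxE -exprS !addrA.
Qed.

Definition stat_mean F (c : 'cV[R]_n) := invmx (1%:M - F) *m c.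

Lemma stat_meanE F c : power_stable F -> F *m stat_mean F c + c = stat_mean F c.
Proof.
move=> /power_stable_unitmx H; apply/esym/eqP; rewrite addrC -subr_eq -[X in X - _]mul1mx.
by rewrite -mulmxBl mulmxA mulmxV // mul1mx.
Qed.

Lemma response_cst F c t : power_stable F ->
  response F (fun=> c) t = stat_mean F c - F ^+ t *m stat_mean F c.
Proof.
move=> H; elim: t => [|t IH] /=; first by rewrite expr0 mul1mx subrr.
rewrite IH mulmxBr addrAC (stat_meanE c H); congr (_ - _).
by rewrite mulmxA mulmxE -exprS.
Qed.

Lemma response_cst_mcvg F c : power_stable F ->
  mcvg (response F (fun=> c)) (stat_mean F c).
Proof.
move=> H i j; under eq_fun do rewrite response_cst //.
have := mcvgD (mcvg_cst (stat_mean F c)) (mcvgN (mcvgM (power_stable_mcvg H) (mcvg_cst (stat_mean F c)))).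
by rewrite mul0mx subr0; exact.
Qed.

(* The matrix of [V |-> F V F^T] acting on vectorized matrices. *)
Definition conj_mx F := lin_mulmx F *m lin_mulmxr F^T : 'M[R]_(n * n).

Lemma conj_mxE F V : mxvec V *m conj_mx F = mxvec (F *m V *m F^T).
Proof. by rewrite mulmxA !mul_vec_lin. Qed.

(** A kernel vector, folded back into a matrix [V], satisfies [V = F V F^T] and is 0 by
    [power_stable_conj0]. *)
Lemma conj_mx_unit F : power_stable F -> 1%:M - conj_mx F \in unitmx.
Proof.
move=> H; rewrite -row_free_unit; apply/row_freeP.
suff : row_free (1%:M - conj_mx F) by move/row_freeP.
rewrite -kermx_eq0; apply/rowV0P => v /sub_kermxP.
rewrite -[v]vec_mxK mulmxBr mulmx1 conj_mxE -linearB /=.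
move=> /eqP; rewrite mxvec_eq0 subr_eq0 => /eqP HV.
by rewrite (power_stable_conj0 H (esym HV)) linear0.
Qed.

(** The solution of the discrete Lyapunov equation, written with a matrix inverse rather than as the
    series of the [F^k W (F^k)^T] to exhibit it as a rational function of [F]. *)
Definition stat_cov F W : 'M[R]_n := vec_mx (mxvec W *m invmx (1%:M - conj_mx F)).

Lemma stat_covE F W : power_stable F -> F *m stat_cov F W *m F^T + W = stat_cov F W.
Proof.
move=> /conj_mx_unit H; apply: (can_inj (@mxvecK _ _ _)).
rewrite linearD /= -conj_mxE /stat_cov vec_mxK; set U := invmx _.
have {2}-> : mxvec W = mxvec W *m U *m (1%:M - conj_mx F).
  by rewrite -mulmxA mulVmx ?mulmx1.
by rewrite mulmxBr mulmx1 addrC subrK.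
Qed.

(** The difference between [C t] and the fixed point obeys the homogeneous recursion, which gives
    the closed form [HC]. *)
Lemma lyapunov_mcvg F W (C : nat -> 'M[R]_n) : power_stable F -> C 0%N = 0 ->
  (forall t, C t.+1 = F *m C t *m F^T + W) -> mcvg C (stat_cov F W).
Proof.
move=> H C0 CS.
have HC t : C t = stat_cov F W - F ^+ t *m stat_cov F W *m (F ^+ t)^T.
  elim: t => [|t IH]; first by rewrite C0 expr0 trmx1 mul1mx mulmx1 subrr.
  rewrite CS IH mulmxBr mulmxBl addrAC (stat_covE W H); congr (_ - _).
  by rewrite exprS -mulmxE trmx_mul !mulmxA.
move=> i j; under eq_fun do rewrite HC.
have H0 := power_stable_mcvg H.
have := mcvgD (mcvg_cst (stat_cov F W)) (mcvgN (mcvgM (mcvgM H0 (mcvg_cst (stat_cov F W))) (mcvgT H0))).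
by rewrite !mul0mx subr0; exact.
Qed.

End Response.

(** * The cost as a function of the first two moments of the state *)

Section StationaryCost.
Variables (R : realType) (n m : nat) (A : 'M[R]_n) (B : 'M[R]_(n, m)).
Variables (Qm : 'M[R]_n) (S : 'cV[R]_n) (Ru : 'M[R]_m) (k : R) (wb : 'cV[R]_n) (W : 'M[R]_n).
Implicit Type X : 'M[R]_(m, n + 1).

(** The uncentered second moment of [u = - K x + l], when [x] has mean [mx] and uncentered second
    moment [Xi]. *)
Definition input_cov X (mx : 'cV[R]_n) (Xi : 'M[R]_n) : 'M[R]_m :=
  let K := lsubmx X in let l := rsubmx X in
  - K *m Xi *m (- K)^T + - K *m mx *m l^T + (- K *m mx *m l^T)^T + l *m l^T.

Definition quad_cost X (mx : 'cV[R]_n) (Xi : 'M[R]_n) : R :=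
  \tr (Qm *m Xi) + 2 * (mx^T *m S) 0 0 + \tr (Ru *m input_cov X mx Xi) - k.

Definition closed_loop_mean X := stat_mean (A - B *m lsubmx X) (B *m rsubmx X + wb).

Definition stat_cost X :=
  let mx := closed_loop_mean X in
  quad_cost X mx (stat_cov (A - B *m lsubmx X) W + mx *m mx^T).

Lemma quad_cost_cvg X (mx : nat -> 'cV[R]_n) (Xi : nat -> 'M[R]_n) mx' Xi' :
  mcvg mx mx' -> mcvg Xi Xi' ->
  (fun t => quad_cost X (mx t) (Xi t)) @ \oo --> quad_cost X mx' Xi'.
Proof.
move=> Hm HX; apply: cvgB; last exact: cvg_cst.
have Hc p q (M : 'M[R]_(p, q)) := mcvg_cst M.
apply: cvgD; [apply: cvgD|].
- by apply: mcvg_tr; apply: mcvgM.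
- by apply: cvgMr; apply: (mcvgM (mcvgT Hm) (Hc _ _ S)).
- apply: mcvg_tr; apply: mcvgM => //.
  have HU := mcvgM (mcvgM (Hc _ _ (- lsubmx X)) Hm) (Hc _ _ (rsubmx X)^T).
  apply: mcvgD => //; apply: mcvgD (mcvgT HU); apply: mcvgD HU.
  by apply: mcvgM => //; exact: mcvgM.
Qed.

Lemma calm1_lsubmx X : calm1_mx (fun Y : 'M[R]_(m, n + 1) => lsubmx Y) X.
Proof. by move=> i j; under eq_fun do rewrite mxE; exact: calm1_mx_id. Qed.

Lemma calm1_rsubmx X : calm1_mx (fun Y : 'M[R]_(m, n + 1) => rsubmx Y) X.
Proof. by move=> i j; under eq_fun do rewrite mxE; exact: calm1_mx_id. Qed.

Lemma calm1_closed_loop X : calm1_mx (fun Y => A - B *m lsubmx Y) X.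
Proof.
apply: calm1_mxD; first exact: calm1_mx_cst; apply: calm1_mxN.
by apply: calm1_mxM; [exact: calm1_mx_cst|exact: calm1_lsubmx].
Qed.

Lemma calm1_mxvec (V : normedModType R) p q (G : V -> 'M[R]_(p, q)) Y :
  calm1_mx G Y -> calm1_mx (fun Z => mxvec (G Z)) Y.
Proof.
move=> H i j; rewrite ord1; case/mxvec_indexP: j => a b.
by under eq_fun do rewrite mxvecE.
Qed.

Lemma calm1_conj_mx (V : normedModType R) (G : V -> 'M[R]_n) Y :
  calm1_mx G Y -> calm1_mx (fun Z => conj_mx (G Z)) Y.
Proof.
move=> H; apply: calm1_mxM => i j; under eq_fun do rewrite mxE /=.
  by apply: calm1_mxvec; apply: calm1_mxM => //; exact: calm1_mx_cst.
by apply: calm1_mxvec; apply: calm1_mxM; [exact: calm1_mx_cst|exact: calm1_mxT].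
Qed.

Lemma calm1_tr (V : normedModType R) p (G : V -> 'M[R]_p) Y :
  calm1_mx G Y -> calm1 (fun Z => \tr (G Z)) Y.
Proof. by move=> H; apply: calm1_sum => i _; exact: H. Qed.

(** Stability supplies the invertibility of [1 - F] and of [1 - conj_mx F]; everything else is sums
    and products of entries of the policy. *)
Lemma calm1_stat_cost X : power_stable (A - B *m lsubmx X) -> calm1 stat_cost X.
Proof.
move=> H.
have Hc p q (M : 'M[R]_(p, q)) : calm1_mx (fun=> M) X by exact: calm1_mx_cst.
have HF := calm1_closed_loop X.
have Hl := calm1_rsubmx X.
have HK := calm1_mxN (calm1_lsubmx X).
have Hm : calm1_mx closed_loop_mean X.
  apply: calm1_mxM; last by apply: calm1_mxD => //; exact: calm1_mxM.
  apply: (@calm1_invmx _ _ _ (fun Y => 1%:M - (A - B *m lsubmx Y))).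
    by apply: calm1_mxD => //; exact: calm1_mxN.
  exact: power_stable_unitmx.
have HC : calm1_mx (fun Y => stat_cov (A - B *m lsubmx Y) W) X.
  move=> i j; under eq_fun do rewrite mxE; apply: calm1_mxM => //.
  apply: (@calm1_invmx _ _ _ (fun Y => 1%:M - conj_mx (A - B *m lsubmx Y))).
    by apply: calm1_mxD => //; apply: calm1_mxN; exact: calm1_conj_mx.
  exact: conj_mx_unit.
have HX := calm1_mxD HC (calm1_mxM Hm (calm1_mxT Hm)).
apply: calm1B; last exact: calm1_cst.
apply: calm1D; [apply: calm1D|].
- exact: calm1_tr (calm1_mxM (Hc _ _ Qm) HX).
- by apply: calm1M; [exact: calm1_cst|apply: calm1_mxM => //; exact: calm1_mxT].
- apply: calm1_tr; apply: calm1_mxM => //.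
  have HU := calm1_mxM (calm1_mxM HK Hm) (calm1_mxT Hl).
  apply: calm1_mxD; last by apply: calm1_mxM => //; exact: calm1_mxT.
  apply: calm1_mxD (calm1_mxT HU); apply: calm1_mxD HU.
  by apply: calm1_mxM (calm1_mxT HK); exact: calm1_mxM.
Qed.

End StationaryCost.

(** * Convergence of the average cost *)

Section SecondOrderProcess.
Context d (T : measurableType d) (R : realType) (P : probability T R) (n : nat).
Variables (F : 'M[R]_n) (v : nat -> T -> 'cV[R]_n) (W : 'M[R]_n).
Hypothesis v_L2 : forall t, L2mx P (v t).
Hypothesis v_mean : forall t, mean_vec P (v t) = 0.
Hypothesis v_cross : forall s t, cross P (v s) (v t) = if s == t then W else 0.

Let y t o := response F (v^~ o) t.

Let yS t : y t.+1 = fun o => F *m y t o + v t o. Proof. by []. Qed.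

Lemma response_L2 t : L2mx P (y t).
Proof.
elim: t => [|t IH]; first exact: L2mx_cst.
by apply: L2mxD => //; exact: L2mx_mulmxl.
Qed.

Lemma response_mean t : mean_vec P (y t) = 0.
Proof.
elim: t => [|t IH]; first exact: mx_expectation_cst.
rewrite /mean_vec mx_expectationD; last 2 first.
- by apply: L1mx_mulmxl; apply: L2mx_L1mx; exact: response_L2.
- exact: L2mx_L1mx.
rewrite mx_expectation_mulmxl; last by apply: L2mx_L1mx; exact: response_L2.
by rewrite -/(mean_vec P (y t)) IH mulmx0 add0r; exact: v_mean.
Qed.

(** [y t] is built from the noise at times strictly before [t], so the case [s = t] is included;
    this case removes the mixed terms of the covariance recursion. *)
Lemma response_cross_noise t s : (t <= s)%N -> cross P (y t) (v s) = 0.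
Proof.
elim: t => [|t IH] ts; first by rewrite /y cross_cstl // mul0mx.
rewrite yS crossDl //; last by apply: L2mx_mulmxl; exact: response_L2.
rewrite crossMl //; last exact: response_L2.
by rewrite IH ?(ltnW ts) // mulmx0 add0r v_cross ltn_eqF.
Qed.

Lemma response_cross t :
  cross P (y t.+1) (y t.+1) = F *m cross P (y t) (y t) *m F^T + W.
Proof.
have Hy := response_L2 t.
have HFy : L2mx P (fun o => F *m y t o) by exact: L2mx_mulmxl.
have HS := response_L2 t.+1.
have yv : cross P (y t) (v t) = 0 by exact: response_cross_noise.
rewrite yS in HS *; rewrite crossDl // !crossDr // !crossMl // !crossMr //.
rewrite yv mulmx0 addr0 -[cross P (v t) (y t)]cross_tr yv trmx0 mul0mx add0r.
by rewrite v_cross eqxx mulmxA.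
Qed.

Lemma response_cross_mcvg : power_stable F ->
  mcvg (fun t => cross P (y t) (y t)) (stat_cov F W).
Proof.
move=> H; apply: lyapunov_mcvg => // [|t]; last exact: response_cross.
by rewrite /y cross_cstl ?mul0mx //; exact: L2mx_cst.
Qed.

End SecondOrderProcess.

(** * Limits of the state moments and of the average cost *)

Section LimitCost.
Context d (T : measurableType d) (R : realType) (P : probability T R) (n m : nat).
Variables (A : 'M[R]_n) (B : 'M[R]_(n, m)) (x0 : T -> 'cV[R]_n).
Variables (w : nat -> T -> 'cV[R]_n) (wb : 'cV[R]_n) (W : 'M[R]_n).
Hypothesis x0_L2 : L2mx P x0.
Hypothesis w_L2 : forall t, L2mx P (w t).
Hypothesis w_mean : forall t, mean_vec P (w t) = wb.
Hypothesis w_cross : forall s t,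
  cross P (fun o => w s o - wb) (fun o => w t o - wb) = if s == t then W else 0.
Variable X : 'M[R]_(m, n + 1).
Let F := A - B *m lsubmx X.
Hypothesis F_stable : power_stable F.

Let v t o := w t o - wb.
Let y t o := response F (v^~ o) t.
Let c := B *m rsubmx X + wb.
Let r t := response F (fun=> c) t.
Let x t o := state A B X (x0 o) (w^~ o) t.

Let v_L2 t : L2mx P (v t).
Proof. by apply: L2mxD => //; exact: L2mx_cst. Qed.

Let v_mean t : mean_vec P (v t) = 0.
Proof.
rewrite /mean_vec mx_expectationD; [|exact: L2mx_L1mx|exact: L1mx_cst].
by rewrite mx_expectation_cst -/(mean_vec P (w t)) w_mean subrr.
Qed.

Let xE t : x t = fun o => F ^+ t *m x0 o + (r t + y t o).
Proof.
apply/funext => o; rewrite /x state_response -/F -responseD; congr (_ + response _ _ _).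
by apply/funext => s; rewrite /c /v -addrA [wb + _]addrC subrK.
Qed.

Let y_L2 t : L2mx P (y t). Proof. exact: response_L2. Qed.

Lemma state_L2 t : L2mx P (x t).
Proof.
rewrite xE; apply: L2mxD; first exact: L2mx_mulmxl.
by apply: L2mxD => //; exact: L2mx_cst.
Qed.

Lemma state_mean_mcvg : mcvg (fun t => mean_vec P (x t)) (closed_loop_mean A B wb X).
Proof.
have E t : mean_vec P (x t) = F ^+ t *m mean_vec P x0 + r t.
  have H1 := L2mx_L1mx x0_L2; have H2 := L2mx_L1mx (y_L2 t).
  rewrite xE /mean_vec mx_expectationD; last 2 first.
  - exact: L1mx_mulmxl.
  - by apply: L1mxD => //; exact: L1mx_cst.
  rewrite mx_expectation_mulmxl // mx_expectationD //; last exact: L1mx_cst.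
  by rewrite mx_expectation_cst -/(mean_vec P (y t)) (response_mean _ v_L2 v_mean) addr0.
move=> i j; under eq_fun do rewrite E.
have := mcvgD (mcvgM (power_stable_mcvg F_stable) (mcvg_cst (mean_vec P x0)))
  (@response_cst_mcvg _ _ F c F_stable).
by rewrite mul0mx add0r; exact.
Qed.

Lemma state_cross_mcvg : mcvg (fun t => cross P (x t) (x t))
  (stat_cov F W + closed_loop_mean A B wb X *m (closed_loop_mean A B wb X)^T).
Proof.
set mX := closed_loop_mean A B wb X.
(* [N] carries the correlation of the initial state with the noise, and [M] that with the drift. The
   products of [r t] with [y t] vanish because [y t] is centered, so seven of the nine terms of the
   expansion remain. *)
pose N t := F ^+ t *m cross P x0 (y t).
pose M t := F ^+ t *m mean_vec P x0 *m (r t)^T.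
have E t : cross P (x t) (x t) =
    F ^+ t *m cross P x0 x0 *m (F ^+ t)^T + (M t + (M t)^T) + (N t + (N t)^T)
    + (cross P (y t) (y t) + r t *m (r t)^T).
  have HF : L2mx P (fun o => F ^+ t *m x0 o) by exact: L2mx_mulmxl.
  have Hr : L2mx P (fun=> r t) by exact: L2mx_cst.
  have Hy := y_L2 t.
  have Hry : L2mx P (fun o => r t + y t o) by exact: L2mxD.
  have Hx : L2mx P (fun o => F ^+ t *m x0 o + (r t + y t o)) by exact: L2mxD.
  have ym : mean_vec P (y t) = 0 by exact: response_mean.
  rewrite xE crossDl // !crossDr // [cross P (fun o => r t + y t o) (fun o => _ *m _)]crossDl //.
  rewrite [cross P (fun o => r t + y t o) (fun=> r t)]crossDl //.
  rewrite [cross P (fun o => r t + y t o) (y t)]crossDl //.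
  rewrite !crossMl // !crossMr // cross_cstr // cross_cstl // cross_cstl // cross_cstr //.
  rewrite [cross P (fun=> r t) (y t)]cross_cstl // ym trmx0 mulmx0 mul0mx addr0 add0r.
  rewrite [mean_vec P (fun=> r t)]mx_expectation_cst /M /N !trmx_mul !trmxK cross_tr !mulmxA.
  by rewrite (AC (1*2*(2*2)) ((1*(2*4))*(3*5)*(7*6))).
move=> i j; under eq_fun do rewrite E.
have F0 := power_stable_mcvg F_stable.
have rm : mcvg r mX by exact: response_cst_mcvg.
have Hc p q (U : 'M[R]_(p, q)) := mcvg_cst U.
have yC : mcvg (fun t => cross P (y t) (y t)) (stat_cov F W) by exact: response_cross_mcvg.
have M0 : mcvg M 0.
  by have := mcvgM (mcvgM F0 (Hc _ _ (mean_vec P x0))) (mcvgT rm); rewrite !mul0mx.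
have N0 : mcvg N 0.
  (* [cross_bound] dominates the correlation by diagonal second moments, one fixed and the other
     convergent. *)
  apply: (@mcvg0_mul _ _ _ _ _ _
    (fun i j t => cross P x0 x0 i i + cross P (y t) (y t) j j)
    (fun i j => cross P x0 x0 i i + stat_cov F W j j)) => // [a b t|a b].
    exact: cross_bound.
  by apply: cvgD; [exact: cvg_cst|exact: yC].
have := mcvgD (mcvgD (mcvgD (mcvgM (mcvgM F0 (Hc _ _ (cross P x0 x0))) (mcvgT F0))
  (mcvgD M0 (mcvgT M0))) (mcvgD N0 (mcvgT N0))) (mcvgD yC (mcvgM rm (mcvgT rm))).
by rewrite !mul0mx trmx0 !addr0 add0r; exact.
Qed.

Lemma input_L2 t : L2mx P (fun o => control X (x t o)).
Proof.
apply: L2mxD; last exact: L2mx_cst.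
by apply: L2mx_mulmxl; exact: state_L2.
Qed.

Lemma cross_input t : cross P (fun o => control X (x t o)) (fun o => control X (x t o))
  = input_cov X (mean_vec P (x t)) (cross P (x t) (x t)).
Proof.
have Hx := state_L2 t; have Hu := input_L2 t.
have HK : L2mx P (fun o => - lsubmx X *m x t o) by exact: L2mx_mulmxl.
have Hl : L2mx P (fun=> rsubmx X) by exact: L2mx_cst.
have Hu' : L2mx P (fun o => - lsubmx X *m x t o + rsubmx X) by exact: Hu.
rewrite /control crossDl // !crossDr // !crossMl // crossMr // cross_cstr // cross_cstl // cross_cstr //.
rewrite [mean_vec P (fun=> rsubmx X)]mx_expectation_cst /input_cov.
rewrite -[mean_vec P (fun o => _ *m x t o)]/(mx_expectation P (fun o => - lsubmx X *m x t o)).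
rewrite mx_expectation_mulmxl; last exact: L2mx_L1mx.
by rewrite -/(mean_vec P (x t)) !trmx_mul !trmxK !mulmxA addrA.
Qed.

Variables (Q : 'M[R]_n) (Ru : 'M[R]_m) (W' : 'M[R]_n) (M3 : 'cV[R]_n) (rho mu : R).
Let Qm := Q + (4 * mu) *: (Q *m W' *m Q).
Let S := (2 * mu) *: (Q *m M3).
Let cost t o := stage_cost Q Ru W' M3 rho mu (x t o) (control X (x t o)).

Lemma stage_cost_L1 t : L1 P (cost t).
Proof.
have Hx := state_L2 t; have Hu := input_L2 t.
apply: (@L1D _ _ _ P _ (fun=> - (mu * rho))); last exact: L1_cst.
apply: L1D; last exact: L1_quad_form.
apply: L1D; first exact: L1_quad_form.
by apply: L1Z; exact: L1_dot.
Qed.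

Lemma Ex_stage_cost t : Ex P (cost t) =
  quad_cost Qm S Ru (mu * rho) X (mean_vec P (x t)) (cross P (x t) (x t)).
Proof.
have Hx := state_L2 t; have Hu := input_L2 t.
have H1 := L1_quad_form Qm Hx; have H2 := L1_quad_form Ru Hu; have H3 := L1_dot S Hx.
rewrite /quad_cost -cross_input -!Ex_quad_form // -Ex_dot // -ExZ //.
have H4 := L1Z 2 H3.
rewrite -ExD // -ExD //; last exact: L1D.
rewrite -[X in _ = _ - X](Ex_cst P) -[X in _ = _ + X]mulN1r -ExZ; last exact: L1_cst.
rewrite -ExD; [|by apply: L1D => //; exact: L1D|by apply: L1Z; exact: L1_cst].
by congr (Ex P _); apply/funext => o; rewrite mulN1r.
Qed.

(** The expected stage costs converge, as continuous functions of convergent moments, and Cesaro's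
    theorem passes to their averages. *)
Lemma average_cost_cvg :
  (fun N : nat => N%:R^-1 * Ex P (fun o => \sum_(t < N) cost t o)) @ \oo -->
    stat_cost A B Qm S Ru (mu * rho) wb W X.
Proof.
have HE N : Ex P (fun o => \sum_(t < N) cost t o) = series (fun t => Ex P (cost t)) N.
  rewrite (@Ex_sum _ _ _ P _ _ (fun t : 'I_N => cost t)) => [|t]; last exact: stage_cost_L1.
  by rewrite seriesEord.
under eq_fun do rewrite HE.
have := @cesaro R (fun t => Ex P (cost t)) (stat_cost A B Qm S Ru (mu * rho) wb W X).
rewrite /arithmetic_mean => Hces.
have Hlim : (fun t => Ex P (cost t)) @ \oo --> stat_cost A B Qm S Ru (mu * rho) wb W X.
  under eq_fun do rewrite Ex_stage_cost.
  by apply: quad_cost_cvg; [exact: state_mean_mcvg|exact: state_cross_mcvg].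
(* The Cesaro mean of index [N] averages [N.+1] terms, so the sequence is shifted by one. *)
have E := cvg_shiftS (fun N : nat => N%:R^-1 * series (fun t => Ex P (cost t)) N)
  (nbhs (stat_cost A B Qm S Ru (mu * rho) wb W X)).
exact: (eq_ind _ id (Hces Hlim) _ E).
Qed.

End LimitCost.

(** * Spectral norm and the noise process *)

Section SpectralNorm.
Variable R : realType.

Lemma l2norm_ge_coord p (v : 'cV[R]_p) i : `|v i 0| <= l2norm v.
Proof.
rewrite -sqrtr_sqr ler_wsqrtr // (bigD1 i) //= lerDl.
by apply: sumr_ge0 => j _; exact: sqr_ge0.
Qed.

Lemma l2norm_le_sum p (v : 'cV[R]_p) (c : R) : (forall i, `|v i 0| <= c) -> l2norm v <= p%:R * c.
Proof.
move=> H; have S0 : 0 <= \sum_(i < p) `|v i 0| by exact: sumr_ge0.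
apply: (@le_trans _ _ (\sum_(i < p) `|v i 0|)); last first.
  apply: (@le_trans _ _ (\sum_(i < p) c)); first by apply: ler_sum => i _.
  by rewrite sumr_const card_ord mulr_natl.
rewrite -[leRHS](ger0_norm S0) -sqrtr_sqr ler_wsqrtr // expr2 mulr_suml.
apply: ler_sum => i _; rewrite -real_normK ?num_real // expr2 ler_wpM2l //.
by rewrite (bigD1 i) //= lerDl; apply: sumr_ge0.
Qed.

Variables p q : nat.
Implicit Type M : 'M[R]_(p, q).

Let image_ball M := [set l2norm (M *m v) | v in [set v : 'cV[R]_q | l2norm v <= 1]].

Let image_ball_ub M : ubound (image_ball M) (p%:R * (q%:R * `|M|)).
Proof.
move=> _ [v /= Hv <-]; apply: l2norm_le_sum => i.
apply: le_trans (normr_entry_le _ _ _) _; apply: le_trans (normr_mulmx_le _ _) _.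
rewrite ler_wpM2l // -[leRHS]mulr1 ler_wpM2l //.
apply: normr_mx_le => // a b; rewrite ord1.
by apply: le_trans Hv; exact: l2norm_ge_coord.
Qed.

(** Together with [normr_le_spectral_norm], this gives the equivalence with the entrywise norm in
    which the neighbourhoods are defined. *)
Lemma spectral_norm_le M : spectral_norm M <= p%:R * (q%:R * `|M|).
Proof.
apply: ge_sup; last exact: image_ball_ub.
exists (l2norm (M *m 0)); exists 0 => //=.
by rewrite /l2norm big1 ?sqrtr0 // => i _; rewrite mxE expr0n.
Qed.

Lemma spectral_norm_ge M (v : 'cV[R]_q) : l2norm v <= 1 -> l2norm (M *m v) <= spectral_norm M.
Proof.
move=> Hv; apply: ub_le_sup; last by exists v.
by exists (p%:R * (q%:R * `|M|)); exact: image_ball_ub.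
Qed.

Lemma normr_le_spectral_norm M : `|M| <= spectral_norm M.
Proof.
apply: normr_mx_le => [|i j].
  apply: (@le_trans _ _ (l2norm (M *m 0))); first exact: sqrtr_ge0.
  apply: spectral_norm_ge; rewrite /l2norm big1 ?sqrtr0 // => i _; by rewrite mxE expr0n.
(* An entry is a coordinate of the image of a standard basis vector, which lies in the unit ball. *)
have -> : M i j = (M *m delta_mx j (0 : 'I_1)) i 0.
  by rewrite -colE mxE.
apply: le_trans (l2norm_ge_coord _ _) _; apply: spectral_norm_ge.
rewrite /l2norm (bigD1 j) //= big1 => [|k kj]; rewrite !mxE ?eqxx ?(negbTE kj) /=.
  by rewrite addr0 expr1n sqrtr1.
by rewrite expr0n.
Qed.

End SpectralNorm.

(** * Borel random vectors and the moments of the noise *)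

Section BorelVectors.
Context d (T : measurableType d) (R : realType) (P : probability T R) (n : nat).

(** Open intervals generate the Borel sets of the line, and their preimages under a continuous
    coordinate are open. *)
Lemma measurable_coord i : measurable_fun setT (fun v : borel_cV R n => (v : 'cV[R]_n) i 0 : R).
Proof.
apply: (measurability (@RGenOpens.G R)); first exact: RGenOpens.measurableE.
move=> _ [_ [a [b ->]] <-]; rewrite setTI; apply: sub_sigma_algebra.
apply: open_comp; last exact: itv_open.
by move=> v _; exact: coord_continuous.
Qed.

Lemma measurable_RV_coord (v : {RV P >-> borel_cV R n}) i :
  measurable_fun setT (fun o => (v o : 'cV[R]_n) i 0).
Proof. by apply: (measurableT_comp (measurable_coord i)). Qed.

Lemma L2mx_l2norm2 (v : {RV P >-> borel_cV R n}) :
  L1 P (fun o => l2norm (v o) ^+ 2) -> L2mx P (v : T -> 'cV[R]_n).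
Proof.
move=> Hv i j; rewrite ord1; split; first exact: measurable_RV_coord.
apply: L1_dominated Hv _; first by apply: measurable_funX; exact: measurable_RV_coord.
by move=> o; rewrite normrX lerXn2r ?nnegrE ?sqrtr_ge0 // l2norm_ge_coord.
Qed.

Lemma L2mx_l2norm4 (v : {RV P >-> borel_cV R n}) :
  L1 P (fun o => l2norm (v o) ^+ 4) -> L2mx P (v : T -> 'cV[R]_n).
Proof.
move=> Hv i j; rewrite ord1; split; first exact: measurable_RV_coord.
apply: L1_dominated (L1D (L1_cst P 1) Hv) _.
  by apply: measurable_funX; exact: measurable_RV_coord.
move=> o; rewrite normrX.
have : `|(v o : 'cV[R]_n) i 0| ^+ 2 <= l2norm (v o) ^+ 2.
  by rewrite lerXn2r ?nnegrE ?sqrtr_ge0 // l2norm_ge_coord.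
move/le_trans; apply; set a := l2norm _.
have -> : a ^+ 4 = (a ^+ 2) ^+ 2 by rewrite -exprM.
have := sqr_ge0 (a ^+ 2 - 1); have := sqr_ge0 a; nra.
Qed.

Variable w : nat -> {RV P >-> borel_cV R n}.

Lemma Ex_identically_distributed (g : borel_cV R n -> R) s t :
  identically_distributed w -> measurable_fun setT g ->
  (forall t, L1 P (fun o => g (w t o))) ->
  Ex P (fun o => g (w s o)) = Ex P (fun o => g (w t o)).
Proof.
move=> Hw mg Hg; apply: EFin_inj; rewrite !Ex_EFin //.
have mg' : measurable_fun setT (EFin \o g) by exact/measurable_EFinP.
have H r : (\int[P]_o (g (w r o))%:E = \int[distribution P (w r)]_x (g x)%:E)%E.
  by rewrite (@integral_distribution _ _ _ _ _ P (w r) (EFin \o g)) //; exact: Hg.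
rewrite !H; apply: eq_measure_integral => A mA _; exact: Hw.
Qed.

Lemma mutually_independent_pair s t (E E' : set (borel_cV R n)) :
  mutually_independent w -> s != t -> measurable E -> measurable E' ->
  P ((w s @^-1` E) `&` (w t @^-1` E')) = (P (w s @^-1` E) * P (w t @^-1` E'))%E.
Proof.
move=> Hw st mE mE'.
have ts : (t == s) = false by rewrite eq_sym (negbTE st).
have := Hw [:: s; t] (fun k => if k == s then E else E').
rewrite !big_cons big_nil eqxx ts mule1 /= inE => <- //.
- congr (P _); apply/seteqP; split => [z [Hs Ht] k /= | z H].
    by rewrite !inE => /orP[/eqP ->|/eqP ->]; rewrite ?eqxx ?ts.
  have Hs := H s; have Ht := H t; rewrite /= !inE !eqxx ?orbT ts in Hs Ht.
  by split; [exact: Hs|exact: Ht].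
- by rewrite st.
- by move=> k _; case: ifP.
Qed.

Hypothesis w_indep : mutually_independent w.
Hypothesis w_ident : identically_distributed w.
Hypothesis w_L2 : forall t, L2mx P (w t : T -> 'cV[R]_n).

Let wb : 'cV[R]_n := mean_vec P (w 0%N).

Lemma noise_mean t : mean_vec P (w t : T -> 'cV[R]_n) = wb.
Proof.
apply/matrixP => i j; rewrite !mxE !ord1.
apply: (@Ex_identically_distributed (fun v => (v : 'cV[R]_n) i 0)) => //; first exact: measurable_coord.
by move=> r; apply: L2_L1; exact: w_L2.
Qed.

Let centered_L2 t i : L2 P (fun o => (w t o : 'cV[R]_n) i 0 - wb i 0).
Proof. by apply: L2D; [exact: w_L2|exact: L2_cst]. Qed.

Let measurable_centered i : measurable_fun setT (fun v : borel_cV R n => (v : 'cV[R]_n) i 0 - wb i 0).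
Proof. by apply: measurable_funD; [exact: measurable_coord|exact: measurable_cst]. Qed.

Let centered_mean t i : Ex P (fun o => (w t o : 'cV[R]_n) i 0 - wb i 0) = 0.
Proof.
rewrite (ExD (L2_L1 (w_L2 t i 0)) (L1_cst P _)) Ex_cst.
have := congr1 (fun v : 'cV[R]_n => v i 0) (noise_mean t).
by rewrite {1}/mean_vec mxE -/(Ex P _) => ->; rewrite subrr.
Qed.

(** For [s = t], identical distribution reduces to time 0. For [s != t], centered coordinates are
    measurable functions of independent vectors, so the expectation of their product is a product of
    zero means. *)
Lemma noise_cross s t :
  cross P (fun o => (w s o : 'cV[R]_n) - wb) (fun o => (w t o : 'cV[R]_n) - wb) =
  if s == t then cov_mx P (w 0%N : T -> 'cV[R]_n) else 0.
Proof.
have crossE r r' i j : cross P (fun o => (w r o : 'cV[R]_n) - wb) (fun o => (w r' o : 'cV[R]_n) - wb) i j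
   = Ex P (fun o => ((w r o : 'cV[R]_n) i 0 - wb i 0) * ((w r' o : 'cV[R]_n) j 0 - wb j 0)).
  rewrite mxE; congr (fine ('E_P[ _ ])%E); apply/funext => o.
  by rewrite mxE big_ord1 !mxE.
apply/matrixP => i j; case: eqVneq => [<-|st].
  rewrite -[RHS]/(cross P (fun o => (w 0%N o : 'cV[R]_n) - wb) (fun o => (w 0%N o : 'cV[R]_n) - wb) i j).
  rewrite !crossE.
  apply: (@Ex_identically_distributed (fun v => ((v : 'cV[R]_n) i 0 - wb i 0) * ((v : 'cV[R]_n) j 0 - wb j 0))) => //.
    by apply: measurable_funM; exact: measurable_centered.
  by move=> r; apply: L2M_L1; exact: centered_L2.
rewrite crossE [RHS]mxE Ex_indep //; first by rewrite centered_mean mul0r.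
move=> D E mD mE.
have mD' := measurable_centered i measurableT mD.
have mE' := measurable_centered j measurableT mE.
rewrite !setTI in mD' mE'.
exact: (mutually_independent_pair w_indep st mD' mE').
Qed.

End BorelVectors.

(** * Local Lipschitz estimates *)

Section LocalLipschitz.
Variables (R : realType) (p q : nat).

Lemma calm1_local_lipschitz (f : 'M[R]_(p, q) -> R) X : calm1 f X ->
  exists xi beta gamma : R,
    [/\ 0 < xi, 0 < beta, 0 < gamma &
      forall X', spectral_norm (X' - X) <= gamma ->
        `|f X' - f X| <= xi * spectral_norm (X' - X) /\
        spectral_norm (gradient f X' - gradient f X)
          <= beta * spectral_norm (X' - X)].
Proof.
move=> [[C C0 HC] Hd].
have {}Hd : forall ij : 'I_p * 'I_q, exists D, 0 <= D /\ \forall Y \near X,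
    `|'D_(delta_mx ij.1 ij.2) f Y - 'D_(delta_mx ij.1 ij.2) f X| <= D * `|Y - X|.
  by move=> ij; have [_ [D D0 HD]] := Hd (delta_mx ij.1 ij.2); exists D.
have [D HD] := choice Hd.
have D0 : 0 <= \sum_ij D ij by apply: sumr_ge0 => ij _; case: (HD ij).
have Hall : \forall Y \near X, forall ij : 'I_p * 'I_q,
    `|'D_(delta_mx ij.1 ij.2) f Y - 'D_(delta_mx ij.1 ij.2) f X| <= D ij * `|Y - X|.
  by apply: (@filter_forall _ _ _ (nbhs X) (nbhs_filter X)) => ij; case: (HD ij).
have : \forall Y \near X, `|f Y - f X| <= C * `|Y - X| /\
    forall ij : 'I_p * 'I_q, `|'D_(delta_mx ij.1 ij.2) f Y - 'D_(delta_mx ij.1 ij.2) f X| <= D ij * `|Y - X|.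
  by apply: filterS2 HC Hall.
move=> /nbhs_normP [e /= e0 He].
(* The sum of the constants [D ij] bounds each of them, and [p q] is the cost of passing from the
   entrywise norm to the spectral norm. *)
pose b := p%:R * (q%:R * \sum_ij D ij).
have b0 : 0 <= b by rewrite !mulr_ge0.
(* Adding 1 makes the constants positive; halving [e] puts a closed spectral ball inside the open
   entrywise one. *)
exists (C + 1), (b + 1), (e / 2); split; rewrite ?ltr_wpDl ?divr_gt0 // => X' HX'.
have hle := normr_le_spectral_norm (X' - X).
have s0 : 0 <= spectral_norm (X' - X) by apply: le_trans hle.
have [H1 H2] : `|f X' - f X| <= C * `|X' - X| /\
    forall ij : 'I_p * 'I_q, `|'D_(delta_mx ij.1 ij.2) f X' - 'D_(delta_mx ij.1 ij.2) f X| <= D ij * `|X' - X|.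
  apply: He; rewrite /= distrC.
  by apply: le_lt_trans hle _; apply: le_lt_trans HX' _; rewrite ltr_pdivrMr // ltr_pMr // ltr1n.
split; first by apply: le_trans H1 _; apply: ler_pM; rewrite ?lerDl.
apply: le_trans (spectral_norm_le _) _.
apply: (@le_trans _ _ (b * `|X' - X|)); last by apply: ler_pM; rewrite ?lerDl.
rewrite /b -!mulrA ler_wpM2l // ler_wpM2l //.
apply: normr_mx_le => [|i j]; first by rewrite mulr_ge0.
rewrite !mxE; apply: le_trans (H2 (i, j)) _; rewrite ler_wpM2r //.
rewrite (bigD1 (i, j)) //= lerDl.
by apply: sumr_ge0 => ij _; case: (HD ij).
Qed.

End LocalLipschitz.

Theorem lemma8 (R : realType) (d : measure_display) (T : measurableType d)
    (P : probability T R) (n m : nat)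
    (A : 'M[R]_n) (B : 'M[R]_(n, m)) (Q Qh : 'M[R]_n) (Ru : 'M[R]_m)
    (x0 : {RV P >-> borel_cV R n}) (w : nat -> {RV P >-> borel_cV R n})
    (rho mu : R)
    (hQ : possemidef Q) (hRu : posdef Ru) (hAB : controllable A B)
    (hQh : is_possemidef_sqrt Q Qh) (hAQ : observable A Qh)
    (w_indep : mutually_independent w)
    (w_ident : identically_distributed w)
    (w_moment4 : forall t,
       P.-integrable setT (fun omega => (l2norm (w t omega) ^+ 4)%:E))
    (w_cov : posdef (cov_mx P (w 0%N)))
    (x0_moment2 : P.-integrable setT (fun omega => (l2norm (x0 omega) ^+ 2)%:E))
    (hmu : 0 <= mu) :
  let L := lagrangian P A B Q Ru x0 w rho mu in
  forall X : 'M[R]_(m, n + 1), stabilizing A B X ->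
  exists xi beta gamma : R,
    [/\ 0 < xi, 0 < beta, 0 < gamma &
      forall X' : 'M[R]_(m, n + 1), stabilizing A B X' ->
        spectral_norm (X' - X) <= gamma ->
        `|L X' - L X| <= xi * spectral_norm (X' - X) /\
        spectral_norm (gradient L X' - gradient L X)
          <= beta * spectral_norm (X' - X)].
Proof.
move=> L X hX.
pose x0' : T -> 'cV[R]_n := x0.
pose w' t : T -> 'cV[R]_n := w t.
pose W := cov_mx P (w' 0%N); pose M3 := third_moment P Q (w' 0%N).
pose G := stat_cost A B (Q + (4 * mu) *: (Q *m W *m Q)) ((2 * mu) *: (Q *m M3)) Ru (mu * rho)
  (mean_vec P (w' 0%N)) W.
have x0_L2 : L2mx P x0' by exact: L2mx_l2norm2.
have w_L2 t : L2mx P (w' t) by apply: L2mx_l2norm4; exact: w_moment4.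
have w_mean t : mean_vec P (w' t) = mean_vec P (w' 0%N) by exact: noise_mean.
have w_cross := noise_cross w_indep w_ident w_L2.
(* [limn] is given its intended value here: the averages converge, and their limit is the stationary
   cost. *)
have LG Y : power_stable (A - B *m lsubmx Y) -> L Y = G Y.
  move=> HY; apply: cvg_lim => //.
  exact: (average_cost_cvg x0_L2 w_L2 w_mean w_cross HY).
have HX : power_stable (A - B *m lsubmx X) by exact: spectral_radius_power_stable.
have calm1L : calm1 L X.
  (* [L] and [G] agree only at stable policies. As these form a neighbourhood of [X], derivatives
     agree near [X] as well. *)
  apply: calm1_near (calm1_stat_cost _ _ _ _ _ _ HX).
  have := near_power_stable (calm1_closed_loop A B X) HX.
  by apply: filterS => Y HY; apply/esym; exact: LG.
have [xi [beta [gamma [xi0 beta0 gamma0 H]]]] := calm1_local_lipschitz calm1L.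
by exists xi, beta, gamma; split => // X' _; exact: H.
Qed.
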